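(* There is a universal constant $C>0$ such that the following holds. Let $\omega=\omega(r,z)$ be an axisymmetric scalar vorticity on $\mathbb{R}^3$ satisfying $r^{-1}\omega\in L^\infty(\mathbb{R}^3)$ and $r\omega\in L^1(\mathbb{R}^3)$, and assume that the corresponding velocity $u=(u^r,u^z)$ belongs to $L^2(\mathbb{R}^3)$. Then $u^r$ is uniformly bounded in space, with $$\|u^r\|_{L^\infty(\mathbb{R}^3)}\le C\,\|u\|_{L^2(\mathbb{R}^3)}^{1/3}\,\Big\|\frac{\omega}{r}\Big\|_{L^\infty(\mathbb{R}^3)}^{1/2}\,\|r\omega\|_{L^1(\mathbb{R}^3)}^{1/6}.$$
   Context: Cylindrical coordinates on $\mathbb{R}^3$: $r=(x_1^2+x_2^2)^{1/2}$, $z=x_3$, with frame $e^r=(x_1/r,x_2/r,0)$, $e^\theta=(-x_2/r,x_1/r,0)$, $e^z=(0,0,1)$. The scalar $\omega(r,z)$ represents the vorticity field $\omega e^\theta$, and the corresponding velocity is given by the Biot--Savart law $u=\nabla\times(-\Delta)^{-1}(\omega e^\theta)$ on $\mathbb{R}^3$, which has the form $u=u^r(r,z)e^r+u^z(r,z)e^z$. $L^p(\mathbb{R}^3)$ norms of functions of $(r,z)$ are with respect to Lebesgue measure on $\mathbb{R}^3$. *)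

(* Defs.v *)
From HB Require Import structures.
From mathcomp Require Import all_boot all_order all_algebra.
From mathcomp Require Import all_classical all_reals all_analysis.

Set Implicit Arguments.
Unset Strict Implicit.
Unset Printing Implicit Defensive.

Import Order.TTheory GRing.Theory Num.Theory.
Import numFieldNormedType.Exports.

Local Open Scope classical_set_scope.
Local Open Scope ring_scope.

(* A point (x_1, x_2, x_3) of R^3 is ((x1, x2), x3) : R * R * R, so that the
   library's binary product measures apply. *)
Notation R3 R := (R * R * R)%type.

Section vector_calculus.
Variable R : realType.
Implicit Types (x y : R3 R) (v : R3 R -> R3 R).

(* measurableTypeR R is R with its Borel sigma-algebra, on which the library
   defines lebesgue_measure. *)
Definition leb3 : {measure set (R3 (measurableTypeR R)) -> \bar R} :=
  ((@lebesgue_measure R \x @lebesgue_measure R) \x @lebesgue_measure R)%E.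

Definition dot x y : R := x.1.1 * y.1.1 + x.1.2 * y.1.2 + x.2 * y.2.

(* The Euclidean norm; the library's `|x| on a product is the max norm. *)
Definition enorm x : R := Num.sqrt (dot x x).

Definition curl v x : R3 R :=
  let v1 := fun y => (v y).1.1 in
  let v2 := fun y => (v y).1.2 in
  let v3 := fun y => (v y).2 in
  let e1 : R3 R := (1, 0, 0) in
  let e2 : R3 R := (0, 1, 0) in
  let e3 : R3 R := (0, 0, 1) in
  ('D_e2 v3 x - 'D_e3 v2 x, 'D_e3 v1 x - 'D_e1 v3 x, 'D_e1 v2 x - 'D_e2 v1 x).

(* (-Delta)^{-1} f on R^3: convolution with the fundamental solution
   1 / (4 pi |x|). *)
Definition inv_neg_laplacian (f : R3 R -> R) x : R :=
  \int[leb3]_y (f y / (4 * pi * enorm (x - y))).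

Definition vec_inv_neg_laplacian v x : R3 R :=
  (inv_neg_laplacian (fun y => (v y).1.1) x,
   inv_neg_laplacian (fun y => (v y).1.2) x,
   inv_neg_laplacian (fun y => (v y).2) x).

Definition biot_savart v : R3 R -> R3 R := curl (vec_inv_neg_laplacian v).

Definition L2_field v : Prop :=
  [/\ (fun x => (v x).1.1) \in Lfun leb3 2%:E,
      (fun x => (v x).1.2) \in Lfun leb3 2%:E &
      (fun x => (v x).2) \in Lfun leb3 2%:E].

End vector_calculus.
Arguments leb3 {R}.

Section cylindrical.
Variable R : realType.
Implicit Types (x : R3 R) (omega : R -> R -> R).

Definition cyl_r x : R := Num.sqrt (x.1.1 ^+ 2 + x.1.2 ^+ 2).

(* On the axis, a null set, both frame vectors are 0 since 0^-1 = 0. *)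
Definition e_r x : R3 R := (x.1.1 / cyl_r x, x.1.2 / cyl_r x, 0).
Definition e_theta x : R3 R := (- x.1.2 / cyl_r x, x.1.1 / cyl_r x, 0).

(* A function of (r, z) seen as a function on R^3; only its values at r >= 0
   matter. *)
Definition axisym omega x : R := omega (cyl_r x) x.2.

Definition vorticity omega x : R3 R := axisym omega x *: e_theta x.

Definition velocity omega : R3 R -> R3 R := biot_savart (vorticity omega).

Definition velocity_r omega x : R := dot (velocity omega x) (e_r x).

End cylindrical.

(* Main.v *)
Require Import Defs.
From HB Require Import structures.
From mathcomp Require Import all_boot all_order all_algebra.
From mathcomp Require Import all_classical all_reals all_analysis.
From mathcomp Require Import measurable_realfun ess_sup_inf.
From mathcomp Require Import ring lra.

Set Implicit Arguments.
Unset Strict Implicit.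
Unset Printing Implicit Defensive.

Import Order.TTheory GRing.Theory Num.Theory.
Import numFieldNormedType.Exports.

Local Open Scope classical_set_scope.
Local Open Scope ring_scope.

(** Write [g = omega / r], [M = |g|_oo], [L = |r omega|_1 = int r^2 |g|] and
    [E = |u|_2].  Since [omega e_theta = g * (- x2, x1, 0)], the horizontal
    velocity is, up to the factor [1 / (4 pi)], the convolution of
    [kern a = a_3 / |a|^3] with [y1 * g] and [y2 * g], two densities bounded by
    [r |g|].  Let [v] be its squared length, so that [(u^r)^2] is at most a
    multiple of [v], and fix a point at distance [r] from the axis.  Up to
    absolute constants, [v] is bounded there in two ways.

    - [v <= M L / r], and [v <= M^2 d^4] where [d^5 = L / M] ([sqr_speed_decay],
      [sqr_speed_global]).  Both come from [majorant = int |x - y|^-2 r_y |g y|]: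
      near [x] one uses [|g| <= M], and far from [x] the arithmetic-geometric
      inequality against the moment [L].  At intermediate distances, the
      axisymmetry of [r^2 |g|] saves a factor [|x - y| / r], because a ring
      around the axis spends only a small part of its length near [x].

    - [v <= E^2 / s^3 + (M s (r + s))^2] for every [s > 0], and also with
      [E^2 / (r s^2)] in place of [E^2 / s^3] ([sqr_speed_le_ball],
      [sqr_speed_le_torus]).  The velocity at [x] differs from a combination of
      its values at [x + h], [x + 2 h] and [x + 3 h] by its third difference.
      The density is at most [M (r + |x - y|)] and grows linearly, while a third
      difference of [kern] decays like [|h|^3 / |a|^5].  The product is then
      integrable at infinity, which a second difference would miss by a
      logarithm, and the third difference is at most [M |h| (r + |h|)]
      ([kern_conv_diff3_le]).  Squaring and averaging over [|h| <= s] puts the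
      energy of [u] on the right; axisymmetry spreads it over a ring of length
      about [r], whence the second form.

    Choosing [s] gives [v^3 <= E^2 M^3 L] ([sqr_speed_cube_le]).  If
    [E^2 <= M^2 r^7], take [E^2 = M^2 r^3 s^4]; then [v <= M^2 s^2 r^2], and one
    multiplies the square of this by [v <= M L / r].  Otherwise take
    [E^2 = M^2 s^7]; then [v <= M^2 s^4], which is combined with [v <= M^2 d^4].
    The sixth root of the result is the theorem.

    That the velocity is this convolution is [potential_derive]: the difference
    quotients of [1 / |a|] are compared with [- kern a] under the integral. *)

(** * Linear changes of variables *)

Section linear_changes_of_variables.
Variable R : realType.
Notation mu := (@lebesgue_measure R).

(** All the substitutions below act on nonnegative integrands, and this form of
    the change of variables is stable under composition and products. *)
Definition scales d (T : measurableType d) (m : {measure set T -> \bar R})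
    (phi : T -> T) (c : R) :=
  [/\ 0 <= c, measurable_fun setT phi &
    forall f, measurable_fun setT f -> (forall x, 0 <= f x)%E ->
      (\int[m]_x f (phi x) = c%:E * \int[m]_x f x)%E].

Lemma scales_comp d (T : measurableType d) (m : {measure set T -> \bar R})
    (phi psi : T -> T) (a b : R) :
  scales m phi a -> scales m psi b -> scales m (phi \o psi) (b * a).
Proof.
move=> [a0 mphi phiE] [b0 mpsi psiE]; split; first exact: mulr_ge0.
  exact: measurableT_comp.
move=> f mf f0; rewrite (psiE (f \o phi)); first by rewrite phiE// EFinM muleA.
  exact: measurableT_comp.
by move=> x; exact: f0.
Qed.

(** By Tonelli, a map that moves only the first coordinate may be substituted
    fibre by fibre; it may depend on the second coordinate, which is what shears
    require. *)
Lemma scales_fst d1 d2 (T1 : measurableType d1) (T2 : measurableType d2)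
    (m1 : {sigma_finite_measure set T1 -> \bar R})
    (m2 : {sigma_finite_measure set T2 -> \bar R}) (F : T1 * T2 -> T1) (c : R) :
  measurable_fun setT F -> 0 <= c -> (forall y, scales m1 (fun x => F (x, y)) c) ->
  scales (m1 \x m2)%E (fun p => (F p, p.2)) c.
Proof.
move=> mF c0 hF; have mphi : measurable_fun setT (fun p => (F p, p.2)).
  exact: measurable_fun_pair.
split=> // f mf f0.
rewrite (fubini_tonelli2 (fun p => f (F p, p.2)))/=; last 2 first.
- exact: (measurableT_comp mf mphi).
- by move=> x; exact: f0.
rewrite /fubini_G/=.
transitivity (\int[m2]_y (c%:E * \int[m1]_x f (x, y)))%E.
  apply: eq_integral => y _; have [_ _ hFy] := hF y.
  apply: (hFy (fun x => f (x, y))) => [|x]; last exact: f0.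
  exact: measurableT_comp.
rewrite ge0_integralZl//; first by rewrite fubini_tonelli2.
- exact: measurable_fun_fubini_tonelli_G.
- by move=> y _; exact: integral_ge0.
Qed.

Lemma scales_snd d1 d2 (T1 : measurableType d1) (T2 : measurableType d2)
    (m1 : {sigma_finite_measure set T1 -> \bar R})
    (m2 : {sigma_finite_measure set T2 -> \bar R}) (F : T1 * T2 -> T2) (c : R) :
  measurable_fun setT F -> 0 <= c -> (forall x, scales m2 (fun y => F (x, y)) c) ->
  scales (m1 \x m2)%E (fun p => (p.1, F p)) c.
Proof.
move=> mF c0 hF; have mphi : measurable_fun setT (fun p => (p.1, F p)).
  exact: measurable_fun_pair.
split=> // f mf f0.
rewrite (fubini_tonelli1 (fun p => f (p.1, F p)))/=; last 2 first.
- exact: (measurableT_comp mf mphi).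
- by move=> x; exact: f0.
rewrite /fubini_F/=.
transitivity (\int[m1]_x (c%:E * \int[m2]_y f (x, y)))%E.
  apply: eq_integral => x _; have [_ _ hFx] := hF x.
  apply: (hFx (fun y => f (x, y))) => [|y]; last exact: f0.
  exact: measurableT_comp.
rewrite ge0_integralZl//; first by rewrite fubini_tonelli1.
- exact: measurable_fun_fubini_tonelli_F.
- by move=> x _; exact: integral_ge0.
Qed.

Lemma measurable_affine (a b : R) : measurable_fun setT (fun t : R => a * t + b).
Proof. by apply: measurable_funD => //; exact: measurable_funM. Qed.

(** The pushforward of Lebesgue measure, multiplied by the slope, gives
    half-open intervals their length, and this determines Lebesgue measure. *)
Lemma scales_affine (a b : R) : 0 < a ->
  scales mu (fun t : R => a * t + b) a^-1.
Proof.
move=> a0; have mab : @measurable_fun _ _ (measurableTypeR R)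
    (measurableTypeR R) setT (fun t => a * t + b) := measurable_affine a b.
split => //; first by rewrite invr_ge0 ltW.
move=> g mg g0.
rewrite -(@ge0_integral_pushforward _ _ (measurableTypeR R) (measurableTypeR R)
  _ _ mab mu setT g)//.
pose p : {measure set (measurableTypeR R) -> \bar R} :=
  measure_function_pushforward__canonical__measure_function_Measure mu mab.
have pE A : p A = mu ((fun t => a * t + b) @^-1` A) by [].
have -> : (\int[mu]_t g t = \int[mscale (NngNum (ltW a0)) p]_t g t)%E.
  apply: eq_measure_integral => A mA _.
  apply: lebesgue_measure_unique => //= _ [[c d]] _ <-.
  have -> B : mscale (NngNum (ltW a0)) p B = (a%:E * p B)%E by [].
  rewrite pE.
  have -> : (fun t => a * t + b) @^-1` `]c, d] =
      `] (c - b) / a, (d - b) / a]%classic.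
    apply/seteqP; split => t /=; rewrite !in_itv/= ltr_pdivrMr// ler_pdivlMr//;
      by rewrite ltrBlDr lerBrDr (mulrC t).
  rewrite !lebesgue_measure_itv/= !lte_fin ltr_pM2r ?invr_gt0// ltrD2r.
  case: ifPn => _; last by rewrite mule0.
  by rewrite -EFinM -mulrBl opprB addrA subrK mulrC divfK// gt_eqF.
by rewrite ge0_integral_mscale// muleA -EFinM mulVf ?gt_eqF// mul1e.
Qed.

Lemma scales_opp : scales mu (fun t : R => - t) 1.
Proof.
have mN : measurable_fun setT (-%R : measurableTypeR R -> measurableTypeR R).
  exact: oppr_measurable.
split=> // g mg g0.
rewrite -(@ge0_integral_pushforward _ _ (measurableTypeR R) (measurableTypeR R)
  _ _ mN mu setT g)// mul1e.
by apply: eq_measure_integral => A mA _; exact: lebesgue_measureN.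
Qed.

Lemma product_measure1_sigma_finite d1 d2 (T1 : measurableType d1)
    (T2 : measurableType d2) (m1 : {sigma_finite_measure set T1 -> \bar R})
    (m2 : {sigma_finite_measure set T2 -> \bar R}) :
  sigma_finite setT (m1 \x m2)%E.
Proof.
have /sigma_finiteP[F [TF ndF Foo]] := sigma_finiteT m1.
have /sigma_finiteP[G [TG ndG Goo]] := sigma_finiteT m2.
exists (fun n => F n `*` G n).
  rewrite -setXTT TF TG predeqE => -[x y]; split.
    move=> [/= [n _ Fnx] [k _ Gky]]; exists (maxn n k) => //; split.
    - by move: x Fnx; exact/subsetPset/ndF/leq_maxl.
    - by move: y Gky; exact/subsetPset/ndG/leq_maxr.
  by move=> [n _ []/= ? ?]; split; exists n.
move=> k; have [? ?] := Foo k; have [? ?] := Goo k.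
split; first exact: measurableX.
by rewrite product_measure1E// lte_mul_pinfty// ge0_fin_numE.
Qed.

(** The product measures under names of their own, to which sigma-finiteness is
    attached for Tonelli's theorem. *)
Definition leb2 : set (measurableTypeR R * measurableTypeR R) -> \bar R :=
  (mu \x mu)%E.

HB.instance Definition _ := Measure.on leb2.
HB.instance Definition _ := Measure_isSigmaFinite.Build _ _ _ leb2
  (product_measure1_sigma_finite mu mu).

Definition sleb3 : set (R3 (measurableTypeR R)) -> \bar R := (leb2 \x mu)%E.

HB.instance Definition _ := Measure.on sleb3.
HB.instance Definition _ := Measure_isSigmaFinite.Build _ _ _ sleb3
  (product_measure1_sigma_finite leb2 mu).

Lemma scales3 (F1 F2 F3 : R -> R) (a b c : R) :
  scales mu F1 a -> scales mu F2 b -> scales mu F3 c ->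
  scales leb3 (fun x => (F1 x.1.1, F2 x.1.2, F3 x.2)) (c * (b * a)).
Proof.
move=> s1 s2 s3; have [a0 m1 _] := s1; have [b0 m2 _] := s2.
have [c0 m3 _] := s3.
have s12 : scales leb2 (fun p => (F1 p.1, F2 p.2)) (b * a).
  have sa := @scales_fst _ _ _ _ mu mu (fun p => F1 p.1) a
    (measurableT_comp m1 measurable_fst) a0 (fun=> s1).
  have sb := @scales_snd _ _ _ _ mu mu (fun p => F2 p.2) b
    (measurableT_comp m2 measurable_snd) b0 (fun=> s2).
  exact: (scales_comp sa sb).
have [ba0 m12 _] := s12.
have sab : scales leb3 (fun p => (F1 p.1.1, F2 p.1.2, p.2)) (b * a).
  exact: (@scales_fst _ _ _ _ leb2 mu _ _ (measurableT_comp m12 measurable_fst) ba0 (fun=> s12)).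
have sc : scales leb3 (fun p => (p.1, F3 p.2)) c.
  exact: (@scales_snd _ _ _ _ leb2 mu _ _ (measurableT_comp m3 measurable_snd) c0 (fun=> s3)).
exact: (scales_comp sab sc).
Qed.

Lemma scales3_affine (k : R) (b : R3 R) : 0 < k ->
  scales leb3 (fun y => b + k *: y) (k ^- 3).
Proof.
move=> k0.
have := scales3 (scales_affine b.1.1 k0) (scales_affine b.1.2 k0)
  (scales_affine b.2 k0).
rewrite -expr2 -exprS exprVn.
suff -> : (fun x => (k * x.1.1 + b.1.1, k * x.1.2 + b.1.2, k * x.2 + b.2)) =
  (fun y => b + k *: y) by [].
by apply/funext => -[[x1 x2] x3]; congr (_, _, _) => /=; rewrite addrC.
Qed.

Lemma scales3_opp : scales leb3 (fun y : R3 R => - y) 1.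
Proof.
have := scales3 scales_opp scales_opp scales_opp; rewrite !mul1r.
suff -> : (fun x : R3 R => (- x.1.1, - x.1.2, - x.2)) = -%R by [].
by apply/funext => -[[x1 x2] x3].
Qed.

Lemma scales3_sub (x : R3 R) : scales leb3 (fun y : R3 R => x - y) 1.
Proof.
have := scales_comp (@scales3_affine 1 x ltr01) scales3_opp.
rewrite expr1n invr1 mulr1.
by congr scales; apply/funext => y /=; rewrite scale1r.
Qed.

Definition rot (c s : R) (x : R3 R) : R3 R :=
  (c * x.1.1 - s * x.1.2, s * x.1.1 + c * x.1.2, x.2).

(** A rotation with [c > 0] is the composite of two substitutions that each
    move one coordinate: first [x1' = c x1 - s x2], with factor [1 / c], then
    [x2' = x2 / c + (s / c) x1'], with factor [c]. *)
Lemma scales3_rot (c s : R) : 0 < c -> c ^+ 2 + s ^+ 2 = 1 ->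
  scales leb3 (rot c s) 1.
Proof.
move=> c0 cs1.
have s1 := @scales_fst _ _ _ _ mu mu (fun p => c * p.1 + (- (s * p.2))) c^-1.
have {}s1 : scales leb2 (fun p => (c * p.1 + (- (s * p.2)), p.2)) c^-1.
  apply: s1; last by move=> y; exact: (scales_affine (- (s * y)) c0).
  - apply: measurable_funD; first exact: measurable_funM.
    by apply: measurableT_comp => //; exact: measurable_funM.
  - by rewrite invr_ge0 ltW.
have s2 := @scales_snd _ _ _ _ mu mu (fun p => c^-1 * p.2 + s / c * p.1) c.
have {}s2 : scales leb2 (fun p => (p.1, c^-1 * p.2 + s / c * p.1)) c.
  apply: s2; [|exact: ltW|].
  - by apply: measurable_funD; exact: measurable_funM.
  - by move=> x; have := @scales_affine c^-1 (s / c * x); rewrite invrK; apply; rewrite invr_gt0.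
have := scales_comp s2 s1; rewrite mulVf ?gt_eqF// => s12.
have [_ m12 _] := s12.
have : scales leb3
    (fun p => (((fun p => (p.1, c^-1 * p.2 + s / c * p.1)) \o
    (fun p => (c * p.1 + (- (s * p.2)), p.2))) p.1, p.2)) 1.
  exact: (@scales_fst _ _ _ _ leb2 mu _ _ (measurableT_comp m12 measurable_fst) ler01 (fun=> s12)).
congr scales; apply/funext => -[[x y] z]; rewrite /rot/=; congr (_, _, _).
have -> : c^-1 * y = c^-1 * y * (c ^+ 2 + s ^+ 2) by rewrite cs1 mulr1.
by field; rewrite gt_eqF.
Qed.

End linear_changes_of_variables.

(** * Integrals of the truncated kernels *)

Section newton_kernel_integrals.
Variable R : realType.
Notation mu := (@lebesgue_measure R).
Implicit Types (a b x y : R3 R) (f : R3 R -> R).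

Lemma measurable_invr : measurable_fun setT (fun t : R => t^-1).
Proof.
have -> : (fun t : R => t^-1) = (fun t => t * (t ^+ 2) `^ (-1)).
  apply/funext => t; rewrite powR_inv1 ?sqr_ge0//.
  have [->|t0] := eqVneq t 0; first by rewrite mul0r invr0.
  by rewrite expr2 invfM mulVKf.
apply: measurable_funM => //.
exact: (measurableT_comp (measurable_powR (-1)) (exprn_measurable 2)).
Qed.

Definition sqn x : R := dot x x.

Lemma sqnE x : sqn x = x.1.1 ^+ 2 + x.1.2 ^+ 2 + x.2 ^+ 2.
Proof. by rewrite /sqn /dot -!expr2. Qed.

Lemma sqn_ge0 x : 0 <= sqn x.
Proof. by rewrite sqnE !addr_ge0 ?sqr_ge0. Qed.

Lemma sqnZ (k : R) x : sqn (k *: x) = k ^+ 2 * sqn x.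
Proof. by rewrite !sqnE /GRing.scale/= /GRing.scale/=; ring. Qed.

Lemma measurable_sqn : measurable_fun setT sqn.
Proof.
rewrite (_ : sqn = fun x => x.1.1 ^+ 2 + x.1.2 ^+ 2 + x.2 ^+ 2); last first.
  by apply/funext => x; rewrite sqnE.
apply: measurable_funD; last exact: measurable_funX.
by apply: measurable_funD; apply: measurable_funX; exact: measurableT_comp.
Qed.

Definition cube (k : R) : set (R3 R) := `[- k, k] `*` `[- k, k] `*` `[- k, k].

Lemma leb3_cube (k : R) : 0 <= k -> leb3 (cube k) = ((2 * k) ^+ 3)%:E.
Proof.
move=> k0.
have I : mu `[- k, k] = (2 * k)%:E.
  rewrite lebesgue_measure_itv/= lte_fin; case: ltP => [_|].
    by rewrite -EFinD opprK mulr2n mulrDl mul1r.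
  move=> kk; have -> : k = 0 by lra.
  by rewrite mulr0.
have E3 := @product_measure1E _ _ _ _ _ (@leb2 R) mu (`[- k, k] `*` `[- k, k])
  `[- k, k] (measurableX (measurable_itv _) (measurable_itv _)) (measurable_itv _).
have E2 := @product_measure1E _ _ _ _ _ mu mu `[- k, k] `[- k, k]
  (measurable_itv _) (measurable_itv _).
pose J := `[- k, k]%classic.
have -> : leb3 (cube k) = (mu J * mu J * mu J)%E.
  by rewrite -E2; exact: E3.
rewrite /J I.
by rewrite -!EFinM; congr EFin; ring.
Qed.

Lemma sqn_lt_cube (k : R) x : 0 <= k -> sqn x < k ^+ 2 -> cube k x.
Proof.
rewrite sqnE => k0 xk.
have h (t : R) : t ^+ 2 < k ^+ 2 -> (- k <= t) && (t <= k).
  by move=> tk; apply/andP; nra.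
have := sqr_ge0 x.1.1; have := sqr_ge0 x.1.2; have := sqr_ge0 x.2 => h1 h2 h3.
by split; [split|]; rewrite /= in_itv/=; apply: h; lra.
Qed.

Lemma measurable_cube k : measurable (cube k).
Proof. by do 2 apply: measurableX => //. Qed.

Definition mnn f := measurable_fun setT f /\ forall x, 0 <= f x.
Definition I3 f : \bar R := (\int[leb3]_x (f x)%:E)%E.

Lemma mnn_m f : mnn f -> measurable_fun setT (EFin \o f).
Proof. by move=> [mf _]; exact: measurableT_comp. Qed.

Lemma mnn_ge0 f x : mnn f -> 0 <= f x. Proof. by case. Qed.

Lemma mnnD f g : mnn f -> mnn g -> mnn (fun x => f x + g x).
Proof.
move=> [mf f0] [mg g0]; split=> [|x]; first exact: measurable_funD.
exact: addr_ge0.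
Qed.

Lemma mnnM f g : mnn f -> mnn g -> mnn (fun x => f x * g x).
Proof.
move=> [mf f0] [mg g0]; split=> [|x]; first exact: measurable_funM.
exact: mulr_ge0.
Qed.

Lemma mnn_cst (c : R) : 0 <= c -> mnn (fun=> c).
Proof. by move=> c0; split. Qed.

Lemma mnnZ (c : R) f : 0 <= c -> mnn f -> mnn (fun x => c * f x).
Proof. by move=> c0; apply: mnnM; exact: mnn_cst. Qed.

Lemma mnn_indic (A : set (R3 R)) : measurable A -> mnn (\1_A : R3 R -> R).
Proof. by move=> mA; split=> [|x]; [exact: measurable_indic|rewrite indicE]. Qed.

Lemma mnn_comp f (phi : R3 R -> R3 R) : measurable_fun setT phi -> mnn f ->
  mnn (f \o phi).
Proof. by move=> mphi [mf f0]; split=> [|x]; [exact: measurableT_comp|exact: f0]. Qed.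

Lemma I3_ge0 f : mnn f -> (0 <= I3 f)%E.
Proof. by move=> [_ f0]; apply: integral_ge0 => x _; rewrite lee_fin. Qed.

Lemma I3_le f g : mnn f -> mnn g -> (forall x, f x <= g x) -> (I3 f <= I3 g)%E.
Proof.
move=> f0 g0 fg; apply: ge0_le_integral => //.
- by move=> x _; rewrite lee_fin; exact: mnn_ge0.
- exact: mnn_m.
- exact: mnn_m.
- by move=> x _; rewrite lee_fin.
Qed.

Lemma I3_ae_le f g : mnn f -> mnn g -> {ae leb3, forall x, f x <= g x} ->
  (I3 f <= I3 g)%E.
Proof.
move=> f0 g0 fg; apply: ae_ge0_le_integral => //.
- by move=> x _; rewrite lee_fin; exact: mnn_ge0.
- exact: mnn_m.
- by move=> x _; rewrite lee_fin; exact: mnn_ge0.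
- exact: mnn_m.
- case: fg => N [mN N0 sub]; exists N; split=> //; apply: subset_trans sub.
  by move=> x /= /not_implyP[_] h; contradict h; rewrite lee_fin.
Qed.

Lemma I3D f g : mnn f -> mnn g -> I3 (fun x => f x + g x) = (I3 f + I3 g)%E.
Proof.
move=> f0 g0; rewrite /I3 -ge0_integralD//.
- by move=> x _; rewrite lee_fin; exact: mnn_ge0.
- exact: mnn_m.
- by move=> x _; rewrite lee_fin; exact: mnn_ge0.
- exact: mnn_m.
Qed.

Lemma I3Z (c : R) f : 0 <= c -> mnn f -> I3 (fun x => c * f x) = (c%:E * I3 f)%E.
Proof.
move=> c0 f0; rewrite /I3 -ge0_integralZl_EFin//; last exact: mnn_m.
by move=> x _; rewrite lee_fin; exact: mnn_ge0.
Qed.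

Lemma I3_scales (phi : R3 R -> R3 R) (c : R) f : scales leb3 phi c -> mnn f ->
  I3 (f \o phi) = (c%:E * I3 f)%E.
Proof.
move=> [_ _ phic] f0; rewrite -phic//; first exact: mnn_m.
by move=> x; rewrite lee_fin; exact: mnn_ge0.
Qed.

Lemma I3_cube (k : R) : 0 <= k -> I3 (\1_(cube k)) = ((2 * k) ^+ 3)%:E.
Proof.
by move=> k0; rewrite /I3 integral_indic ?setIT ?leb3_cube//; exact: measurable_cube.
Qed.

(** Monotone convergence, for sequences that are eventually stationary at every
    point. *)
Lemma I3_sup f (fn : nat -> R3 R -> R) (B : \bar R) :
  (forall n, mnn (fn n)) -> (forall x, nondecreasing_seq (fn ^~ x)) ->
  (forall x, \forall n \near \oo, fn n x = f x) ->
  (forall n, I3 (fn n) <= B)%E -> (I3 f <= B)%E.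
Proof.
move=> fn0 ndfn fnf fnB.
have cv : (fun n => I3 (fn n)) @ \oo --> I3 f.
  have -> : I3 f = (\int[leb3]_x limn (fun n => (fn n x)%:E))%E.
    apply: eq_integral => x _; apply/esym/cvg_lim => //.
    apply: cvg_near_cst => //.
    by apply: filterS (fnf x) => n ->.
  apply: cvg_monotone_convergence => //.
  - by move=> n; exact: mnn_m.
  - by move=> n x _; rewrite lee_fin; exact: mnn_ge0.
  - by move=> x _ m n mn; rewrite lee_fin; exact: ndfn.
have <- := cvg_lim _ cv; last exact: ereal_hausdorff.
by apply: lime_le; [apply/cvg_ex; eexists; exact: cv|exact: nearW].
Qed.

(** A bound on the integral of a power of [|x|] without polar coordinates.
    Rescaling the inequality gives [int f_n <= V |cube| + (1/2) int f_n], and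
    the last term can be absorbed since the truncations [f_n] are integrable. *)
Lemma I3_self_similar f (fn : nat -> R3 R -> R) (k c l V : R) :
  0 < k -> 0 <= c -> c * k ^- 3 <= 2^-1 -> 0 <= l -> 0 <= V ->
  (forall n, mnn (fn n)) -> (forall x, nondecreasing_seq (fn ^~ x)) ->
  (forall x, \forall n \near \oo, fn n x = f x) ->
  (forall n, I3 (fn n) < +oo)%E ->
  (forall n x, fn n x <= V * \1_(cube l) x + c * fn n (k *: x)) ->
  (I3 f <= (2 * (V * (2 * l) ^+ 3))%:E)%E.
Proof.
move=> k0 c0 ck l0 V0 fn0 ndfn fnf fnoo fnss; apply: (I3_sup fn0) => // n.
have sk := scales3_affine 0 k0.
have fnk : mnn (fn n \o (fun y => 0 + k *: y)).
  by apply: mnn_comp => //; have [] := sk.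
have mcube : mnn (fun x => V * \1_(cube l) x).
  by apply: mnnZ => //; apply: mnn_indic; exact: measurable_cube.
have : (I3 (fn n) <= (V * (2 * l) ^+ 3)%:E + (2^-1)%:E * I3 (fn n))%E.
  pose h x := V * \1_(cube l) x + c * (fn n \o (fun y => 0 + k *: y)) x.
  have fh : (I3 (fn n) <= I3 h)%E.
    apply: I3_le => // [|x]; first by apply: mnnD => //; exact: mnnZ.
    by rewrite /h /= add0r.
  apply: (le_trans fh); rewrite /h.
  rewrite I3D//; last exact: mnnZ.
  rewrite I3Z//; last by apply: mnn_indic; exact: measurable_cube.
  rewrite I3_cube// -EFinM leeD2l// I3Z// (I3_scales sk)// muleA -EFinM.
  by rewrite lee_wpmul2r ?lee_fin ?I3_ge0.
have : I3 (fn n) \is a fin_num.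
  by rewrite ge0_fin_numE ?I3_ge0.
case: (I3 (fn n)) => // r _.
by rewrite -EFinM -EFinD !lee_fin; lra.
Qed.

(** The two truncated kernels carry all singular integrals of the proof:
    [|x|^-2] near the origin and [|x|^-4] away from it. *)
Definition near_kernel (rho : R) x : R := if sqn x < rho ^+ 2 then (sqn x)^-1 else 0.
Definition far_kernel (rho : R) x : R :=
  if rho ^+ 2 <= sqn x then (sqn x) ^- 2 else 0.

Lemma mnn_near rho : mnn (near_kernel rho).
Proof.
split=> [|x]; last by rewrite /near_kernel; case: ifP; rewrite ?invr_ge0 ?sqn_ge0.
apply: measurable_fun_ifT => //.
  by apply: measurable_fun_ltr => //; exact: measurable_sqn.
by apply: (measurableT_comp measurable_invr); exact: measurable_sqn.
Qed.

Lemma mnn_far rho : mnn (far_kernel rho).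
Proof.
split=> [|x].
  apply: measurable_fun_ifT => //.
    by apply: measurable_fun_ler => //; exact: measurable_sqn.
  apply: (measurableT_comp measurable_invr); apply: measurable_funX; exact: measurable_sqn.
by rewrite /far_kernel; case: ifP; rewrite ?invr_ge0 ?exprn_ge0 ?sqn_ge0.
Qed.

(** The truncation [min (|x|^-2, n)] is compared with itself at [2 x]: the
    factor [4] against the Jacobian [8]. *)
Lemma I3_near1 : (I3 (near_kernel 1) <= 64%:E)%E.
Proof.
pose fn n x := if sqn x < 1 then Num.min (sqn x)^-1 n%:R else 0.
have fn0 n : mnn (fn n).
  split=> [|x].
    apply: measurable_fun_ifT => //.
      by apply: measurable_fun_ltr => //; exact: measurable_sqn.
    apply: measurable_minr => //.
    by apply: (measurableT_comp measurable_invr); exact: measurable_sqn.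
  by rewrite /fn; case: ifP => // _; rewrite le_min invr_ge0 sqn_ge0/=.
apply: (@le_trans _ _ (2 * (4 * (2 * 1) ^+ 3))%:E); last by rewrite lee_fin; lra.
have cubeP x : sqn x < 1 -> \1_(cube 1) x = 1 :> R.
  move=> x1; rewrite indicE mem_set//; apply: sqn_lt_cube => //.
  by rewrite expr1n.
have cube_ge0 x : 0 <= \1_(cube 1) x :> R by rewrite indicE.
apply: (@I3_self_similar _ fn 2 4 1 4) => //.
- lra.
- move=> x m n mn; rewrite /fn; case: ifP => // _.
  by rewrite le_min ge_min lexx/= ge_min ler_nat mn orbT.
- move=> x; rewrite /near_kernel expr1n; near=> n; rewrite /fn; case: ifP => // _.
  apply/min_idPl; near: n; exact: nbhs_infty_ger.
- move=> n; apply: (@le_lt_trans _ _ (I3 (fun x => n%:R * \1_(cube 1) x))).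
    apply: I3_le => // [|x].
      by apply: mnnZ => //; apply: mnn_indic; exact: measurable_cube.
    rewrite /fn; case: ifPn => [x1|_]; last by rewrite mulr_ge0.
    by rewrite cubeP// mulr1 ge_min lexx orbT.
  rewrite I3Z//; last by apply: mnn_indic; exact: measurable_cube.
  by rewrite I3_cube// -EFinM ltry.
- move=> n x; rewrite /fn sqnZ.
  case: ifPn => [x1|_]; last first.
    by rewrite addr_ge0 ?mulr_ge0//; case: ifP; rewrite ?le_min ?invr_ge0 ?mulr_ge0 ?sqn_ge0//=.
  rewrite cubeP// mulr1; case: ifPn => [x4|].
    rewrite invfM; have : 0 <= (sqn x)^-1 by rewrite invr_ge0 sqn_ge0.
    have : 0 <= n%:R :> R by [].
    by rewrite !minEle; do 2 case: ifPn; rewrite -?ltNge; lra.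
  rewrite -leNgt mulr0 addr0 => x4; rewrite ge_min; apply/orP; left.
  by rewrite invf_ple ?posrE//; lra.
Unshelve. all: by end_near. Qed.

(** Here the function is cut off at [|x| < n] and compared with itself at
    [x / 2]: the factor [1 / 16] against the Jacobian [1 / 8]. *)
Lemma I3_far1 : (I3 (far_kernel 1) <= 128%:E)%E.
Proof.
pose fn n x := if 1 <= sqn x then if sqn x < n%:R ^+ 2 then (sqn x) ^- 2 else 0 else 0.
have fn0 n : mnn (fn n).
  split=> [|x].
    apply: measurable_fun_ifT => //.
      by apply: measurable_fun_ler => //; exact: measurable_sqn.
    apply: measurable_fun_ifT => //.
      by apply: measurable_fun_ltr => //; exact: measurable_sqn.
    by apply: (measurableT_comp measurable_invr); apply: measurable_funX; exact: measurable_sqn.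
  by rewrite /fn; do 2 case: ifP => //; rewrite invr_ge0 exprn_ge0 ?sqn_ge0.
apply: (@le_trans _ _ (2 * (1 * (2 * 2) ^+ 3))%:E); last by rewrite lee_fin; lra.
have cubeP (k : nat) x : sqn x < k%:R ^+ 2 -> \1_(cube k%:R) x = 1 :> R.
  by move=> x1; rewrite indicE mem_set//; exact: sqn_lt_cube.
have cube_ge0 (k : R) x : 0 <= \1_(cube k) x :> R by rewrite indicE.
have inv1 x : 1 <= sqn x -> sqn x ^- 2 <= 1.
  by move=> x1; rewrite invf_le1 ?exprn_ege1// exprn_gt0//; lra.
apply: (@I3_self_similar _ fn 2^-1 16^-1 2 1) => //.
- rewrite exprVn invrK; lra.
- move=> x m n mn; rewrite /fn; case: ifP => // _; case: ifPn => xm.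
    rewrite ifT// (lt_le_trans xm)// lerXn2r ?nnegrE// ler_nat//.
  by case: ifP => //; rewrite invr_ge0 exprn_ge0 ?sqn_ge0.
- move=> x; rewrite /far_kernel expr1n; near=> n; rewrite /fn; case: ifP => // x1.
  rewrite ifT//.
  have xn : sqn x + 1 <= n%:R by near: n; exact: nbhs_infty_ger.
  by rewrite expr2; nra.
- move=> n; apply: (@le_lt_trans _ _ (I3 (\1_(cube n%:R)))).
    apply: I3_le => // [|x].
      by apply: mnn_indic; exact: measurable_cube.
    rewrite /fn; case: ifPn => // x1; case: ifPn => // xn.
    by rewrite cubeP// inv1.
  by rewrite I3_cube// ltry.
- move=> n x; rewrite /fn sqnZ.
  have i16 : 0 <= (16^-1 : R) by rewrite invr_ge0.
  case: ifPn => [x1|_]; last first.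
    rewrite addr_ge0 ?mulr_ge0//; do 2 case: ifP => //.
    by rewrite invr_ge0 exprn_ge0// mulr_ge0 ?sqn_ge0.
  case: ifPn => [xn|_]; last first.
    rewrite addr_ge0 ?mulr_ge0//; do 2 case: ifP => //.
    by rewrite invr_ge0 exprn_ge0// mulr_ge0 ?sqn_ge0.
  rewrite mul1r; have [x4|x4] := ltP (sqn x) (2 ^+ 2).
    rewrite cubeP// (le_trans (inv1 _ x1))// lerDl mulr_ge0//; do 2 case: ifP => //.
    by rewrite invr_ge0 exprn_ge0// mulr_ge0 ?sqn_ge0.
  rewrite -[leLHS]add0r; apply: lerD; first exact: cube_ge0.
  rewrite ifT; last by lra.
  rewrite ifT; last by lra.
  have x0 : sqn x != 0 by rewrite gt_eqF//; lra.
  by rewrite le_eqVlt; apply/orP; left; apply/eqP; field.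
Unshelve. all: by end_near. Qed.

Lemma I3_near rho : 0 < rho -> (I3 (near_kernel rho) <= (64 * rho)%:E)%E.
Proof.
move=> rho0; have sk := scales3_affine 0 rho0.
have : I3 (near_kernel rho \o (fun y => 0 + rho *: y)) =
    ((rho ^- 2)%:E * I3 (near_kernel 1))%E.
  rewrite -I3Z ?invr_ge0 ?exprn_ge0 ?ltW//; last exact: mnn_near.
  congr I3; apply/funext => x; rewrite /= add0r /near_kernel sqnZ expr1n.
  rewrite -[X in _ < X]mulr1 ltr_pM2l ?exprn_gt0//.
  by case: ifP => _; rewrite ?mulr0// invfM.
rewrite (I3_scales sk); last exact: mnn_near.
move=> /(congr1 (mule (rho ^+ 3)%:E)); rewrite !muleA -!EFinM.
rewrite mulfV ?expf_neq0 ?gt_eqF// mul1e => ->.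
rewrite exprS mulfK ?expf_neq0 ?gt_eqF//.
rewrite mulrC EFinM lee_pmul2l ?lte_fin//; exact: I3_near1.
Qed.

Lemma I3_far rho : 0 < rho -> (I3 (far_kernel rho) <= (128 / rho)%:E)%E.
Proof.
move=> rho0; have sk := scales3_affine 0 rho0.
have : I3 (far_kernel rho \o (fun y => 0 + rho *: y)) =
    ((rho ^- 4)%:E * I3 (far_kernel 1))%E.
  rewrite -I3Z ?invr_ge0 ?exprn_ge0 ?ltW//; last exact: mnn_far.
  congr I3; apply/funext => x; rewrite /= add0r /far_kernel sqnZ expr1n.
  rewrite -[X in X <= _]mulr1 ler_pM2l ?exprn_gt0//.
  by case: ifP => _; rewrite ?mulr0// exprMn -exprM invfM.
rewrite (I3_scales sk); last exact: mnn_far.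
move=> /(congr1 (mule (rho ^+ 3)%:E)); rewrite !muleA -!EFinM.
rewrite mulfV ?expf_neq0 ?gt_eqF// mul1e => ->.
rewrite (exprSr _ 3) invfM mulrA mulfV ?expf_neq0 ?gt_eqF// mul1r.
rewrite mulrC EFinM lee_pmul2l ?lte_fin ?invr_gt0//; exact: I3_far1.
Qed.

End newton_kernel_integrals.

(** * Averaging over rotations about the axis *)

Section rotation_average.
Variable R : realType.
Notation mu := (@lebesgue_measure R).
Implicit Types (x y : R3 R) (f : R3 R -> R) (t : R).

Lemma integral_oneDsqr_le : (\int[mu]_t ((1 + t ^+ 2)^-1)%:E <= 4%:E)%E.
Proof.
pose G t : \bar R := ((1 + t ^+ 2)^-1)%:E.
have mG : measurable_fun setT G.
  apply: measurableT_comp => //; apply: (measurableT_comp (@measurable_invr R)).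
  by apply: measurable_funD => //; exact: measurable_funX.
have G0 t : (0 <= G t)%E by rewrite lee_fin invr_ge0 addr_ge0// sqr_ge0.
have h1 : (\int[mu]_(t in `[0%R, +oo[) G t = (pi / 2)%:E)%E.
  exact: integral0y_oneDsqr.
have h2 : (\int[mu]_(t in `]-oo, 0%R]) G t = (pi / 2)%:E)%E.
  rewrite -h1 ge0_integration_by_substitution0//.
  by apply: eq_integral => t _; rewrite /G sqrrN.
have -> : (\int[mu]_t G t = \int[mu]_(t in `]-oo, 0%R] `|` `]0%R, +oo[) G t)%E.
  congr integral; apply/seteqP; split => // t _ /=; rewrite !in_itv/= andbT.
  by have [?|?] := leP t 0; [left|right].
rewrite ge0_integral_setU//; last 2 first.
- exact: measurable_funTS.
- apply/disj_setPS => t []/=; rewrite !in_itv/= andbT => t0.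
  by rewrite ltNge t0.
have h3 : (\int[mu]_(t in `]0%R, +oo[) G t <= (pi / 2)%:E)%E.
  rewrite -h1; apply: ge0_subset_integral => //; first exact: measurable_funTS.
  by move=> t /=; rewrite !in_itv/= !andbT => /ltW.
rewrite h2; apply: le_trans (leeD2l _ h3) _.
by rewrite -EFinD lee_fin; have := @pihalf_lt2 R; lra.
Qed.

Definition rsq x : R := x.1.1 ^+ 2 + x.1.2 ^+ 2.

Lemma rsqB x y : rsq (x - y) = (x.1.1 - y.1.1) ^+ 2 + (x.1.2 - y.1.2) ^+ 2.
Proof. by []. Qed.

(** The rational parametrization of the circle, [t] being the tangent of half the
    angle: it makes rotation by an angle an algebraic function of [t], and
    [0 <= t <= 1/2] is a range of angles of fixed length. *)
Definition rot_cos t : R := (1 - t ^+ 2) / (1 + t ^+ 2).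
Definition rot_sin t : R := (2 * t) / (1 + t ^+ 2).
Definition rott t := rot (rot_cos t) (rot_sin t).

Lemma rot_cos_sin t : rot_cos t ^+ 2 + rot_sin t ^+ 2 = 1.
Proof.
rewrite /rot_cos /rot_sin; field.
by rewrite gt_eqF// ltr_pwDl// sqr_ge0.
Qed.

Lemma rot_cos_gt0 t : 0 <= t <= 2^-1 -> 0 < rot_cos t.
Proof.
by move=> t01; rewrite divr_gt0//; [nra|rewrite ltr_pwDl// sqr_ge0].
Qed.

(** The chord between the two rotated points has length
    [2 |y| |t - s| / sqrt ((1 + t^2) (1 + s^2))]. *)
Lemma rott_sub_ge (s t : R) y : 0 <= s <= 2^-1 -> 0 <= t <= 2^-1 ->
  rsq y * (t - s) ^+ 2 <= rsq (rott t y - rott s y).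
Proof.
move=> s01 t01.
have -> : rsq (rott t y - rott s y) =
   rsq y * (t - s) ^+ 2 * (4 / ((1 + t ^+ 2) * (1 + s ^+ 2))).
  rewrite rsqB /rsq /rott /rot /rot_cos /rot_sin /=.
  by field; rewrite !gt_eqF ?ltr_pwDl ?sqr_ge0.
apply: ler_peMr; first by rewrite mulr_ge0 ?sqr_ge0// addr_ge0 ?sqr_ge0.
rewrite ler_pdivlMr ?mulr_gt0 ?ltr_pwDl ?sqr_ge0// mul1r.
have : t ^+ 2 <= 1 by nra.
have : s ^+ 2 <= 1 by nra.
have := sqr_ge0 t; have := sqr_ge0 s; nra.
Qed.

Lemma continuous_rsq_rott x y : continuous (fun t => rsq (x - rott t y)).
Proof.
have c2 : continuous (fun t : R => (1 + t ^+ 2)^-1).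
  move=> t; apply: cvgV; first by rewrite gt_eqF ?ltr_pwDl ?sqr_ge0.
  by apply: cvgD; [exact: cvg_cst|exact: exprn_continuous].
have cc : continuous rot_cos.
  move=> t; apply: cvgM; last exact: c2.
  by apply: cvgB; [exact: cvg_cst|exact: exprn_continuous].
have cs : continuous rot_sin.
  move=> t; apply: cvgM; last exact: c2.
  by apply: cvgM; [exact: cvg_cst|exact: cvg_id].
have cX (g : R -> R) : continuous g -> continuous (fun t => g t ^+ 2).
  by move=> cg t; apply: (@continuous_comp _ _ _ g (fun t => t ^+ 2));
    [exact: cg|exact: exprn_continuous].
have cb (a b c : R) : continuous (fun t => a - (b * rot_cos t + c * rot_sin t)).
  move=> t; apply: cvgB; first exact: cvg_cst.
  by apply: cvgD; apply: cvgM; first [exact: cvg_cst|exact: cc|exact: cs].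
rewrite (_ : (fun t => _) = fun t =>
    (x.1.1 - (y.1.1 * rot_cos t + (- y.1.2) * rot_sin t)) ^+ 2 +
    (x.1.2 - (y.1.2 * rot_cos t + y.1.1 * rot_sin t)) ^+ 2).
  by move=> t; apply: cvgD; exact: (cX _ (cb _ _ _) t).
by apply/funext => t; rewrite rsqB /rott /rot/=; ring.
Qed.

Lemma sqnB_rsq x y : sqn (x - y) = rsq (x - y) + (x.2 - y.2) ^+ 2.
Proof. by rewrite sqnE. Qed.

Lemma rsq_rott t y : rsq (rott t y) = rsq y.
Proof.
rewrite /rsq /rott /rot/=.
transitivity ((y.1.1 ^+ 2 + y.1.2 ^+ 2) * (rot_cos t ^+ 2 + rot_sin t ^+ 2)).
  by ring.
by rewrite rot_cos_sin mulr1.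
Qed.

Lemma rsq_le2 x y : rsq x <= 2 * rsq (x - y) + 2 * rsq y.
Proof.
rewrite rsqB /rsq.
by have := sqr_ge0 (x.1.1 - 2 * y.1.1); have := sqr_ge0 (x.1.2 - 2 * y.1.2); nra.
Qed.

(** The orbit of [y] moves away from [x] at speed at least [r / 4] from the
    parameter [s] where it is closest to [x].  If [y] is near the axis, the whole
    orbit stays far from [x]; otherwise the chord from [rott s y] to [rott t y] is
    at least [(r / 2) |t - s|], and by the choice of [s] its length is at most twice
    the distance from [x] to [rott t y]. *)
Lemma rott_dist_ge (r : R) x y : 0 < r -> rsq x = r ^+ 2 ->
  exists s, forall t, 0 <= t <= 2^-1 ->
    (r / 4 * (t - s)) ^+ 2 <= sqn (x - rott t y).
Proof.
move=> r0 xr.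
have half01 : (0 : R) <= 2^-1 by rewrite invr_ge0.
have [s s01 smin] := EVT_min half01
  (continuous_subspaceT (@continuous_rsq_rott x y)).
move: s01; rewrite in_itv/= => s01.
have sq_le t : rsq (x - rott t y) <= sqn (x - rott t y).
  by rewrite sqnB_rsq lerDl sqr_ge0.
have [yr|yr] := leP (rsq y) (r ^+ 2 / 4).
  exists 0 => t t01; apply: le_trans (sq_le t).
  have := rsq_le2 x (rott t y); rewrite rsq_rott xr subr0 exprMn.
  have : 0 <= t ^+ 2 <= 1 by apply/andP; nra.
  have := sqr_ge0 r; nra.
(* y is away from the axis: pass through the closest point rott s y *)
exists s => t t01; apply: le_trans (sq_le t).
have h1 := rott_sub_ge y s01 t01.
have h2 := smin t; rewrite in_itv/= t01 in h2; have {}h2 := h2 isT.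
have h3 : rsq (rott t y - rott s y) <=
    2 * rsq (x - rott t y) + 2 * rsq (x - rott s y).
  move: (rott t y) (rott s y) => p q; rewrite !rsqB.
  have := sqr_ge0 ((x.1.1 - p.1.1) + (x.1.1 - q.1.1)).
  by have := sqr_ge0 ((x.1.2 - p.1.2) + (x.1.2 - q.1.2)); nra.
have h4 : r ^+ 2 / 4 * (t - s) ^+ 2 <= rsq y * (t - s) ^+ 2.
  by rewrite ler_wpM2r ?sqr_ge0// ltW.
rewrite exprMn; nra.
Qed.

Lemma integral_lorentz_le (rho c s : R) : 0 < rho -> 0 < c ->
  (\int[mu]_t ((rho ^+ 2 + (c * (t - s)) ^+ 2)^-1)%:E <= (4 / (rho * c))%:E)%E.
Proof.
move=> rho0 c0.
pose a := c / rho; have a0 : 0 < a by rewrite divr_gt0.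
pose G (t : R) : \bar R := ((1 + t ^+ 2)^-1)%:E.
have mG : measurable_fun setT G.
  apply: measurableT_comp => //; apply: (measurableT_comp (@measurable_invr R)).
  by apply: measurable_funD => //; exact: measurable_funX.
have G0 t : (0 <= G t)%E by rewrite lee_fin invr_ge0 addr_ge0// sqr_ge0.
have [_ mab sG] := scales_affine (- (a * s)) a0.
have -> : (\int[mu]_t ((rho ^+ 2 + (c * (t - s)) ^+ 2)^-1)%:E =
    (rho ^- 2)%:E * \int[mu]_t G (a * t + (- (a * s)))%R)%E.
  rewrite -ge0_integralZl_EFin//; last 2 first.
  - exact: (measurableT_comp mG mab).
  - by rewrite invr_ge0 sqr_ge0.
  apply: eq_integral => t _; rewrite /G -EFinM; congr EFin.
  rewrite /a -invfM; congr (_^-1).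
  by field; rewrite gt_eqF.
rewrite sG// muleA -EFinM.
have k0 : 0 <= rho ^- 2 * a^-1 by rewrite mulr_ge0 ?invr_ge0 ?sqr_ge0 ?ltW.
apply: (@le_trans _ _ ((rho ^- 2 * a^-1)%:E * 4%:E)%E).
  by apply: lee_wpmul2l; [rewrite lee_fin|exact: integral_oneDsqr_le].
rewrite -EFinM lee_fin /a le_eqVlt; apply/orP; left; apply/eqP.
by field; rewrite !gt_eqF.
Qed.

Lemma measurable_rott : measurable_fun setT (fun p : R * R3 R => rott p.1 p.2).
Proof.
have mc : measurable_fun setT rot_cos.
  apply: measurable_funM.
    by apply: measurable_funB => //; exact: measurable_funX.
  apply: (measurableT_comp (@measurable_invr R)).
  by apply: measurable_funD => //; exact: measurable_funX.
have ms : measurable_fun setT rot_sin.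
  apply: measurable_funM; first exact: measurable_funM.
  apply: (measurableT_comp (@measurable_invr R)).
  by apply: measurable_funD => //; exact: measurable_funX.
have mc1 : measurable_fun setT (fun p : R * R3 R => rot_cos p.1) by exact: measurableT_comp.
have ms1 : measurable_fun setT (fun p : R * R3 R => rot_sin p.1) by exact: measurableT_comp.
have m1 : measurable_fun setT (fun p : R * R3 R => p.2.1.1).
  by apply: measurableT_comp => //; exact: measurableT_comp.
have m2 : measurable_fun setT (fun p : R * R3 R => p.2.1.2).
  by apply: measurableT_comp => //; exact: measurableT_comp.
have m3 : measurable_fun setT (fun p : R * R3 R => p.2.2).
  exact: measurableT_comp.
apply: measurable_fun_pair => //; apply: measurable_fun_pair => //=.
  by apply: measurable_funB; exact: measurable_funM.
by apply: measurable_funD; exact: measurable_funM.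
Qed.

Definition rot_invariant f := forall c s y, 0 < c -> c ^+ 2 + s ^+ 2 = 1 -> f (rot c s y) = f y.

(** A smooth substitute for the indicator of the ball of radius [rho], up to the
    factor [rho^2]. *)
Definition lorentz (rho : R) x : R := (rho ^+ 2 + sqn x)^-1.

Lemma mnn_lorentz rho : mnn (lorentz rho).
Proof.
split=> [|x]; last by rewrite invr_ge0 addr_ge0 ?sqr_ge0 ?sqn_ge0.
apply: (measurableT_comp (@measurable_invr R)); apply: measurable_funD => //.
exact: measurable_sqn.
Qed.

Lemma measurable_sub x : measurable_fun setT (fun y : R3 R => x - y).
Proof. by have [] := scales3_sub x. Qed.

(** Since [f] is invariant, [y] may be replaced by [rott t y], and then one
    averages over [t] in [0, 1/2].  By [rott_dist_ge] the weight becomes a Lorentz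
    profile in [t] whose integral is [16 / (r rho)] at most, whatever [y] is. *)
Lemma I3_rot_invariant f (r rho : R) x : mnn f -> rot_invariant f ->
  0 < r -> rsq x = r ^+ 2 -> 0 < rho ->
  (I3 (fun y => (f y * lorentz rho (x - y))%R) <= (32 / (r * rho))%:E * I3 f)%E.
Proof.
move=> f0 finv r0 xr rho0.
pose J : set R := `[0, 2^-1]%classic.
have mJ : measurable J by exact: measurable_itv.
pose F (p : R * R3 R) : \bar R :=
  (\1_J p.1 * (f p.2 * lorentz rho (x - rott p.1 p.2)))%:E.
have w0 z : 0 <= lorentz rho z by exact: mnn_ge0 (mnn_lorentz rho).
have F0 p : (0 <= F p)%E.
  by rewrite lee_fin !mulr_ge0//; exact: mnn_ge0.
have mF : measurable_fun setT F.
  apply: measurableT_comp => //; apply: measurable_funM.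
    by apply: (measurableT_comp (measurable_indic mJ)).
  apply: measurable_funM; first by apply: measurableT_comp => //; exact: (proj1 f0).
  apply: (measurableT_comp (proj1 (mnn_lorentz rho))).
  exact: (measurableT_comp (measurable_sub x) measurable_rott).
have fw0 : mnn (fun y => f y * lorentz rho (x - y)).
  apply: mnnM => //.
  by apply: (mnn_comp (measurable_sub x)); exact: mnn_lorentz.
have FT := @fubini_tonelli _ _ _ _ _ mu (@sleb3 R) F mF F0.
(* integrating first in y, the rotation is undone; 1/2 is the length of J *)
have E1 : (\int[mu]_t \int[sleb3 (R:=R)]_y F (t, y) =
    (2^-1)%:E * I3 (fun y => (f y * lorentz rho (x - y))%R))%E.
  transitivity (\int[mu]_t ((\1_J t)%:E * I3 (fun y => (f y * lorentz rho (x - y))%R)))%E.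
    apply: eq_integral => t _; rewrite /F/= indicE.
    have [/set_mem|_] := boolP (t \in J); last first.
      by rewrite mul0e; under eq_integral do rewrite mul0r; rewrite integral0.
    rewrite /J /= in_itv/= => t01; rewrite mul1e.
    under eq_integral do rewrite mul1r.
    have srot := scales3_rot (rot_cos_gt0 t01) (rot_cos_sin t).
    rewrite -[RHS]mul1e -(I3_scales srot fw0).
    by apply: eq_integral => y _ /=; rewrite finv ?rot_cos_sin ?rot_cos_gt0.
  rewrite ge0_integralZr ?I3_ge0//; last by apply/measurable_EFinP; exact: measurable_indic.
  rewrite integral_indic// setIT; congr (_ * _)%E.
  by rewrite [LHS]lebesgue_measure_itv/= lte_fin invr_gt0 ltr0n oppr0 adde0.
(* integrating first in t *)
have E2 : (\int[sleb3 (R:=R)]_y \int[mu]_t F (t, y) <=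
   (16 / (r * rho))%:E * I3 f)%E.
  have c0 : 0 <= 16 / (r * rho) by rewrite divr_ge0// mulr_ge0// ltW.
  rewrite -I3Z//; apply: ge0_le_integral => //.
  - by move=> y _; apply: integral_ge0.
  - exact: (@measurable_fun_fubini_tonelli_G _ _ _ _ _ mu F).
  - by apply: mnn_m; exact: mnnZ.
  move=> y _; have [s sP] := rott_dist_ge y r0 xr.
  have f0y := mnn_ge0 y f0.
  apply: (@le_trans _ _ (\int[mu]_t ((f y)%:E *
      ((rho ^+ 2 + (r / 4 * (t - s)) ^+ 2)^-1)%:E))%E).
    apply: ge0_le_integral => //.
    - exact: (measurableT_comp mF).
    - apply: emeasurable_funM => //; apply: measurableT_comp => //.
      apply: (measurableT_comp (@measurable_invr R)); apply: measurable_funD => //.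
      apply: measurable_funX; apply: measurable_funM => //.
      exact: measurable_funB.
    move=> t _; rewrite /F/= -EFinM lee_fin indicE.
    have [/set_mem|_] := boolP (t \in J); last first.
      by rewrite mul0r mulr_ge0 ?invr_ge0 ?addr_ge0 ?sqr_ge0.
    rewrite /J /= in_itv/= => t01; rewrite mul1r ler_wpM2l// lef_pV2 ?posrE.
    - by rewrite lerD2l sP.
    - by rewrite ltr_wpDr ?sqn_ge0 ?exprn_gt0.
    - by rewrite ltr_wpDr ?sqr_ge0 ?exprn_gt0.
  rewrite ge0_integralZl_EFin//; last 2 first.
  - by move=> t _; rewrite lee_fin invr_ge0 addr_ge0 ?sqr_ge0.
  - apply: measurableT_comp => //.
    apply: (measurableT_comp (@measurable_invr R)); apply: measurable_funD => //.
    apply: measurable_funX; apply: measurable_funM => //.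
    exact: measurable_funB.
  apply: (@le_trans _ _ ((f y)%:E * (4 / (rho * (r / 4)))%:E)%E).
    by apply: lee_wpmul2l; [rewrite lee_fin|apply: integral_lorentz_le => //; rewrite divr_gt0].
  rewrite -EFinM lee_fin le_eqVlt; apply/orP; left; apply/eqP.
  by field; rewrite !gt_eqF.
have : ((2^-1)%:E * I3 (fun y => (f y * lorentz rho (x - y))%R) <=
    (16 / (r * rho))%:E * I3 f)%E by rewrite -E1 FT.
move: (I3 _) (I3 f) => a b ab.
have -> : a = (2%:E * ((2^-1)%:E * a))%E by rewrite muleA -EFinM mulfV// mul1e.
have -> : ((32 / (r * rho))%:E * b = 2%:E * ((16 / (r * rho))%:E * b))%E.
  by rewrite muleA -EFinM mulrA; congr (_%:E * _)%E; congr (_ / _); ring.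
by apply: lee_wpmul2l => //; rewrite lee_fin.
Qed.

End rotation_average.

(** * The integral that dominates the velocity *)

Section triangle_inequalities.
Variable R : realType.
Implicit Types (x y a : R3 R).

Lemma cyl_r_ge0 x : 0 <= cyl_r x. Proof. exact: sqrtr_ge0. Qed.

Lemma sqr_cyl_r x : cyl_r x ^+ 2 = rsq x.
Proof. by rewrite sqr_sqrtr// addr_ge0 ?sqr_ge0. Qed.

Lemma enorm_ge0 x : 0 <= enorm x. Proof. exact: sqrtr_ge0. Qed.

Lemma sqr_enorm x : enorm x ^+ 2 = sqn x.
Proof. by rewrite sqr_sqrtr// sqn_ge0. Qed.

Lemma ler_sqrP (p q : R) : 0 <= q -> p ^+ 2 <= q ^+ 2 -> p <= q.
Proof.
move=> q0; have [/ltW p0 _|p0] := ltP p 0; first exact: le_trans q0.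
by rewrite ler_sqr ?nnegrE.
Qed.

Lemma dot_le x y : dot x y <= enorm x * enorm y.
Proof.
apply: ler_sqrP; first by rewrite mulr_ge0 ?enorm_ge0.
rewrite exprMn !sqr_enorm !sqnE /dot -subr_ge0.
rewrite (_ : _ - _ = (x.1.1 * y.1.2 - x.1.2 * y.1.1) ^+ 2 +
  (x.1.1 * y.2 - x.2 * y.1.1) ^+ 2 + (x.1.2 * y.2 - x.2 * y.1.2) ^+ 2); last by ring.
by rewrite !addr_ge0 ?sqr_ge0.
Qed.

Lemma sqnD x y : sqn (x + y) = sqn x + 2 * dot x y + sqn y.
Proof.
rewrite !sqnE /dot (_ : (x + y).1.1 = x.1.1 + y.1.1)//.
rewrite (_ : (x + y).1.2 = x.1.2 + y.1.2)// (_ : (x + y).2 = x.2 + y.2)//.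
by ring.
Qed.

Lemma enormD x y : enorm (x + y) <= enorm x + enorm y.
Proof.
apply: ler_sqrP; first by rewrite addr_ge0 ?enorm_ge0.
rewrite sqrrD sqr_enorm sqnD !sqr_enorm lerD2r lerD2l.
by have := dot_le x y; lra.
Qed.

Lemma enormZ (k : R) x : enorm (k *: x) = `|k| * enorm x.
Proof.
by rewrite /enorm -/(sqn _) sqnZ sqrtrM ?sqr_ge0// sqrtr_sqr.
Qed.

Lemma enormN x : enorm (- x) = enorm x.
Proof. by rewrite -scaleN1r enormZ normrN1 mul1r. Qed.

Lemma enorm_lt x (rho : R) : 0 <= rho -> (enorm x < rho) = (sqn x < rho ^+ 2).
Proof. by move=> rho0; rewrite -sqr_enorm ltr_sqr ?nnegrE// enorm_ge0. Qed.

Lemma enorm_eq0 x : enorm x = 0 -> x = 0.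
Proof.
move=> x0; have : sqn x = 0 by rewrite -sqr_enorm x0 expr0n.
case: x {x0} => [[a b] c]; rewrite sqnE /= => h.
have := sqr_ge0 a; have := sqr_ge0 b; have := sqr_ge0 c => c0 b0 a0.
by congr (_, _, _); apply/eqP; rewrite -sqrf_eq0; apply/eqP; lra.
Qed.

Lemma cyl_r_enorm x : cyl_r x <= enorm x.
Proof.
apply: ler_sqrP; first exact: enorm_ge0.
by rewrite sqr_cyl_r sqr_enorm sqnE lerDl sqr_ge0.
Qed.

Definition horiz x : R3 R := (x.1, 0).

Lemma cyl_rE x : cyl_r x = enorm (horiz x).
Proof. by rewrite /cyl_r /enorm /dot/= mulr0 addr0 -!expr2. Qed.

Lemma cyl_r_triangle x y : cyl_r y <= cyl_r x + enorm (x - y).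
Proof.
rewrite !cyl_rE (_ : horiz y = horiz x + - horiz (x - y)); last first.
  rewrite /horiz; congr pair; last by rewrite /= subr0.
  by rewrite [LHS](_ : _ = x.1 - (x.1 - y.1))// opprB addrC subrK.
apply: le_trans (enormD _ _) _; rewrite lerD2l enormN -cyl_rE.
exact: cyl_r_enorm.
Qed.

Lemma measurable_cyl_r : measurable_fun setT (@cyl_r R).
Proof.
have ms : measurable_fun setT (Num.sqrt : R -> R).
  exact: continuous_measurable_fun (@sqrt_continuous R).
apply: (measurableT_comp ms); apply: measurable_funD; apply: measurable_funX;
  exact: measurableT_comp.
Qed.

Lemma measurable_enorm : measurable_fun setT (@enorm R).
Proof.
have ms : measurable_fun setT (Num.sqrt : R -> R).
  exact: continuous_measurable_fun (@sqrt_continuous R).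
exact: (measurableT_comp ms (@measurable_sqn R)).
Qed.

End triangle_inequalities.

Section velocity_majorant.
Variables (R : realType) (g : R3 R -> R) (M L : R).
Hypotheses (mg : measurable_fun setT g) (M0 : 0 < M) (L0 : 0 < L).
Hypothesis gM : {ae leb3, forall y, `|g y| <= M}.
Hypothesis ginv : rot_invariant g.
Implicit Types (x y : R3 R).

(** For [g = omega / r] this is [|r omega|]. *)
Definition moment y : R := rsq y * `|g y|.
Hypothesis gL : (I3 moment <= L%:E)%E.

(** For [g = omega / r] this is [|omega|], the size of the vorticity. *)
Definition swirl y : R := cyl_r y * `|g y|.
Definition majorant x : \bar R := I3 (fun y => (sqn (x - y))^-1 * swirl y).

Lemma mnn_moment : mnn moment.
Proof.
split=> [|y]; last by rewrite /moment mulr_ge0// addr_ge0 ?sqr_ge0.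
apply: measurable_funM; last exact: measurableT_comp.
by apply: measurable_funD; apply: measurable_funX; exact: measurableT_comp.
Qed.

Lemma mnn_swirl : mnn swirl.
Proof.
split=> [|y]; last by rewrite /swirl mulr_ge0// cyl_r_ge0.
by apply: measurable_funM; [exact: measurable_cyl_r|exact: measurableT_comp].
Qed.

Lemma mnn_inv_sqn : mnn (fun x : R3 R => (sqn x)^-1).
Proof.
split=> [|y]; last by rewrite invr_ge0 sqn_ge0.
by apply: (measurableT_comp (@measurable_invr R)); exact: measurable_sqn.
Qed.

Lemma mnn_sub f x : mnn f -> mnn (fun y : R3 R => f (x - y)).
Proof. by move=> f0; apply: (mnn_comp (measurable_sub x)). Qed.

Lemma I3_sub f x : mnn f -> I3 (fun y : R3 R => f (x - y)) = I3 f.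
Proof. by move=> f0; rewrite (I3_scales (scales3_sub x) f0) mul1e. Qed.

Lemma mnn_majorant x : mnn (fun y => (sqn (x - y))^-1 * swirl y).
Proof. apply: mnnM; [exact: (mnn_sub x mnn_inv_sqn)|exact: mnn_swirl]. Qed.

(** Young's inequality [p c <= (lam / 2) c^2 + p^2 / (2 lam)] with [c = r_y] and
    [p = |x - y|^-2]. *)
Lemma swirl_far (lam rho : R) x y : 0 < lam -> `|g y| <= M ->
  rho ^+ 2 <= sqn (x - y) ->
  (sqn (x - y))^-1 * swirl y <=
    lam / 2 * moment y + M / (2 * lam) * far_kernel rho (x - y).
Proof.
move=> lam0 gy qy; rewrite /far_kernel qy /swirl /moment -sqr_cyl_r.
have p0 : 0 <= (sqn (x - y))^-1 by rewrite invr_ge0 sqn_ge0.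
rewrite -exprVn; move: p0 (cyl_r_ge0 y) (normr_ge0 (g y)) gy.
move: (sqn _)^-1 (cyl_r y) `|_| => p c v p0 c0 v0 vM.
apply: (@le_trans _ _ (v * (lam / 2 * c ^+ 2 + p ^+ 2 / (2 * lam)))); last first.
  rewrite mulrDr; apply: lerD; first by rewrite le_eqVlt; apply/orP; left; apply/eqP; ring.
  rewrite [leRHS](_ : _ = M * (p ^+ 2 / (2 * lam))); last by ring.
  by rewrite ler_wpM2r// divr_ge0 ?sqr_ge0// mulr_ge0// ltW.
rewrite (_ : p * (c * v) = v * (p * c)); last by ring.
apply: ler_wpM2l => //; rewrite -subr_ge0.
rewrite (_ : _ - _ = (lam * c - p) ^+ 2 / (2 * lam)).
  by rewrite divr_ge0 ?sqr_ge0// mulr_ge0// ltW.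
by field; rewrite gt_eqF.
Qed.

(** Within distance [rho] of [x] the density is at most [M (r + rho)]; farther
    away [swirl_far] applies.  The parameters [rho] and [lam] remain free. *)
Lemma majorant_le (rho lam : R) x : 0 < rho -> 0 < lam ->
  (majorant x <= (64 * (M * ((cyl_r x + rho) * rho) + lam * L + M / (lam * rho)))%:E)%E.
Proof.
move=> rho0 lam0.
pose a := (cyl_r x + rho) * M.
have a0 : 0 <= a by rewrite mulr_ge0 ?addr_ge0 ?cyl_r_ge0// ltW.
pose b := lam / 2; have b0 : 0 <= b by rewrite divr_ge0// ltW.
pose c := M / (2 * lam); have c0 : 0 <= c by rewrite divr_ge0 ?mulr_ge0// ltW.
pose F y := a * near_kernel rho (x - y) + (b * moment y + c * far_kernel rho (x - y)).
have n0 : mnn (fun y => near_kernel rho (x - y)):= mnn_sub x (mnn_near _).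
have f0 : mnn (fun y => far_kernel rho (x - y)):= mnn_sub x (mnn_far _).
have m0 := mnn_moment.
have an0 := mnnZ a0 n0; have bm0 := mnnZ b0 m0; have cf0 := mnnZ c0 f0.
have F0 : mnn F by apply: mnnD => //; exact: mnnD.
have : (majorant x <= I3 F)%E.
  apply: I3_ae_le => //; first exact: mnn_majorant.
  case: gM => N [mN N0 sub]; exists N; split=> //; apply: subset_trans sub.
  move=> y /= h gy; apply: h; rewrite /F.
  have [qy|qy] := leP (rho ^+ 2) (sqn (x - y)).
    by rewrite -[leLHS]add0r lerD ?(mnn_ge0 _ an0)// swirl_far.
  rewrite -[leLHS]addr0 lerD ?(mnn_ge0 _ (mnnD bm0 cf0))// /near_kernel qy.
  rewrite mulrC ler_wpM2r ?invr_ge0 ?sqn_ge0// /swirl ler_pM ?cyl_r_ge0//.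
  by apply: le_trans (cyl_r_triangle x y) _; rewrite lerD2l ltW// enorm_lt// ltW.
move=> h; apply: (le_trans h); rewrite /F I3D//; last exact: mnnD.
rewrite I3D// !I3Z// (I3_sub _ (mnn_near _)) (I3_sub _ (mnn_far _)).
have e1 : (a%:E * I3 (near_kernel rho) <= (a * (64 * rho))%:E)%E.
  by rewrite (EFinM a); apply: lee_wpmul2l; [rewrite lee_fin|exact: I3_near].
have e2 : (b%:E * I3 moment <= (b * L)%:E)%E.
  by rewrite (EFinM b); apply: lee_wpmul2l; [rewrite lee_fin|].
have e3 : (c%:E * I3 (far_kernel rho) <= (c * (128 / rho))%:E)%E.
  by rewrite (EFinM c); apply: lee_wpmul2l; [rewrite lee_fin|exact: I3_far].
apply: le_trans (leeD e1 (leeD e2 e3)) _; rewrite -!EFinD lee_fin /a /b /c.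
rewrite (_ : M / (2 * lam) * (128 / rho) = 64 * (M / (lam * rho))); last first.
  by field; rewrite !gt_eqF.
have : 0 < lam * L by rewrite mulr_gt0.
lra.
Qed.

(** Within distance [rho] one bounds [|g|] by [M], and beyond [r / 2] one uses
    [swirl_far].  In between, [r_y >= r / 2], so the density is at most
    [(2 / r) r_y^2 |g|], whose invariance under rotation makes [I3_rot_invariant]
    applicable. *)
Lemma majorant_le_axis (rho lam : R) x : 0 < rho -> 0 < lam -> 0 < cyl_r x ->
  (majorant x <= (128 * (M * (cyl_r x * rho) + L / (cyl_r x ^+ 2 * rho) + lam * L +
     M / (lam * cyl_r x)))%:E)%E.
Proof.
move=> rho0 lam0 r0; set r := cyl_r x in r0 *.
pose a := 2 * r * M; have a0 : 0 <= a by rewrite !mulr_ge0// ltW.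
pose b := lam / 2; have b0 : 0 <= b by rewrite divr_ge0// ltW.
pose c := M / (2 * lam); have c0 : 0 <= c by rewrite divr_ge0 ?mulr_ge0// ltW.
pose d := 4 / r; have d0 : 0 <= d by rewrite divr_ge0// ltW.
pose F y := a * near_kernel rho (x - y) +
  (d * (moment y * lorentz rho (x - y)) +
  (b * moment y + c * far_kernel (r / 2) (x - y))).
have n0 : mnn (fun y => near_kernel rho (x - y)):= mnn_sub x (mnn_near _).
have f0 : mnn (fun y => far_kernel (r / 2) (x - y)):= mnn_sub x (mnn_far _).
have m0 := mnn_moment.
have l0 : mnn (fun y => moment y * lorentz rho (x - y)).
  by apply: mnnM => //; exact: (mnn_sub x (mnn_lorentz _)).
have an0 := mnnZ a0 n0; have bm0 := mnnZ b0 m0; have cf0 := mnnZ c0 f0.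
have dl0 := mnnZ d0 l0.
have F0 : mnn F by apply: mnnD => //; apply: mnnD => //; exact: mnnD.
have : (majorant x <= I3 F)%E.
  apply: I3_ae_le => //; first exact: mnn_majorant.
  case: gM => N [mN N0 sub]; exists N; split=> //; apply: subset_trans sub.
  move=> y /= h gy; apply: h; rewrite /F.
  have [qy|qy] := leP ((r / 2) ^+ 2) (sqn (x - y)).
    rewrite -[leLHS]add0r lerD ?(mnn_ge0 _ an0)//.
    by rewrite -[leLHS]add0r lerD ?(mnn_ge0 _ dl0)// swirl_far.
  have yr : enorm (x - y) < r / 2 by rewrite enorm_lt// divr_ge0// ltW.
  have [qr|qr] := ltP (sqn (x - y)) (rho ^+ 2).
    rewrite -[leLHS]addr0 lerD ?(mnn_ge0 _ (mnnD dl0 (mnnD bm0 cf0)))//.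
    rewrite /near_kernel qr mulrC ler_wpM2r ?invr_ge0 ?sqn_ge0//.
    rewrite /swirl ler_pM ?cyl_r_ge0//.
    by apply: le_trans (cyl_r_triangle x y) _; rewrite -/r; lra.
  rewrite -[leLHS]add0r lerD ?(mnn_ge0 _ an0)//.
  rewrite -[leLHS]addr0 lerD ?(mnn_ge0 _ (mnnD bm0 cf0))//.
  have ry : r / 2 <= cyl_r y.
    by have := cyl_r_triangle y x; rewrite -/r -[y - x]opprB enormN; lra.
  have q0 : 0 < sqn (x - y) by apply: lt_le_trans qr; rewrite exprn_gt0.
  apply: (@le_trans _ _ (2 * lorentz rho (x - y) * (2 / r * moment y))); last first.
    by rewrite /d le_eqVlt; apply/orP; left; apply/eqP; ring.
  apply: ler_pM.
  - by rewrite invr_ge0 ltW.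
  - exact: mnn_ge0 mnn_swirl.
  - have p0 : 0 < rho ^+ 2 + sqn (x - y) by rewrite addr_gt0// exprn_gt0.
    by rewrite /lorentz ler_pdivlMr// mulrC ler_pdivrMr//; lra.
  - rewrite /swirl /moment -sqr_cyl_r mulrA ler_wpM2r// expr2 mulrA.
    by rewrite ler_peMl ?cyl_r_ge0// mulrAC ler_pdivlMr// mul1r; lra.
move=> h; apply: (le_trans h); rewrite /F I3D//; last by apply: mnnD => //; exact: mnnD.
rewrite I3D//; last exact: mnnD.
rewrite I3D// !I3Z// (I3_sub _ (mnn_near _)) (I3_sub _ (mnn_far _)).
have e1 : (a%:E * I3 (near_kernel rho) <= (a * (64 * rho))%:E)%E.
  by rewrite (EFinM a); apply: lee_wpmul2l; [rewrite lee_fin|exact: I3_near].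
have e2 : (b%:E * I3 moment <= (b * L)%:E)%E.
  by rewrite (EFinM b); apply: lee_wpmul2l; [rewrite lee_fin|].
have e3 : (c%:E * I3 (far_kernel (r / 2)) <= (c * (128 / (r / 2)))%:E)%E.
  rewrite (EFinM c); apply: lee_wpmul2l; first by rewrite lee_fin.
  by apply: I3_far; rewrite divr_gt0.
have minv : rot_invariant moment.
  move=> e s y e0 es; rewrite /moment ginv// /rsq /rot/=; congr (_ * _).
  transitivity ((y.1.1 ^+ 2 + y.1.2 ^+ 2) * (e ^+ 2 + s ^+ 2)); first by ring.
  by rewrite es mulr1.
have e4 : (d%:E * I3 (fun y => (moment y * lorentz rho (x - y))%R) <=
    (d * (32 / (r * rho) * L))%:E)%E.
  rewrite (EFinM d); apply: lee_wpmul2l; first by rewrite lee_fin.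
  apply: le_trans (I3_rot_invariant m0 minv r0 _ rho0) _.
    by rewrite -sqr_cyl_r.
  rewrite (EFinM (32 / (r * rho))); apply: lee_wpmul2l => //.
  by rewrite lee_fin divr_ge0// mulr_ge0// ltW.
apply: le_trans (leeD e1 (leeD e4 (leeD e2 e3))) _.
rewrite -!EFinD lee_fin /a /b /c /d.
rewrite (_ : M / (2 * lam) * (128 / (r / 2)) = 128 * (M / (lam * r))); last first.
  by field; rewrite !gt_eqF.
rewrite (_ : 4 / r * (32 / (r * rho) * L) = 128 * (L / (r ^+ 2 * rho))); last first.
  by field; rewrite !gt_eqF.
have : 0 < lam * L by rewrite mulr_gt0.
lra.
Qed.

End velocity_majorant.

(** * Third differences of the kernel *)

Section third_difference.
Variable R : realType.
Implicit Types (f df F G : R -> R) (t : R).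

Lemma mean_value f df (a : R) :
  (forall t, a <= t <= a + 1 -> is_derive t 1 f (df t)) ->
  exists2 c, a <= c <= a + 1 & f (a + 1) - f a = df c.
Proof.
move=> fdf; have aa1 : a < a + 1 by rewrite ltrDl.
have [||c ca ->] := @MVT R f df a (a + 1) aa1.
- by move=> t; rewrite in_itv/= => /andP[/ltW h1 /ltW h2]; apply: fdf; rewrite h1.
- apply: derivable_within_continuous => t; rewrite in_itv/= => h.
  exact: (@ex_derive _ _ _ _ _ _ _ (fdf t h)).
- exists c; last by rewrite addrAC subrr add0r mulr1.
  by move: ca; rewrite in_itv/= => /andP[/ltW -> /ltW ->].
Qed.

Lemma is_derive_translate f (c t d : R) : is_derive (t + c) 1 f d ->
  is_derive t 1 (fun u => f (u + c)) d.
Proof.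
move=> h; have := @is_derive1_comp R f (fun u => u + c) t d 1.
rewrite mulr1; apply => //; apply: is_derive_shift.
Qed.

(** Three applications of the mean value theorem: the third difference of [f] is
    a value of [f3]. *)
Lemma third_difference_le f (f1 f2 f3 : R -> R) (B : R) :
  (forall t, 0 <= t <= 3 -> is_derive t 1 f (f1 t)) ->
  (forall t, 0 <= t <= 3 -> is_derive t 1 f1 (f2 t)) ->
  (forall t, 0 <= t <= 3 -> is_derive t 1 f2 (f3 t)) ->
  (forall t, 0 <= t <= 3 -> `|f3 t| <= B) ->
  `|f 3 - 3 * f 2 + 3 * f 1 - f 0| <= B.
Proof.
move=> d1 d2 d3 fB.
have [|c c01] := @mean_value (fun u => f (u + 2) - 2 * f (u + 1) + f u)
    (fun u => f1 (u + 2) - 2 * f1 (u + 1) + f1 u) 0.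
  move=> t; rewrite add0r => t01.
  apply: is_deriveD; last by apply: d1; lra.
  apply: is_deriveB; first by apply: is_derive_translate; apply: d1; lra.
  apply: is_deriveZ; apply: is_derive_translate; apply: d1; lra.
rewrite !add0r => E1.
have [|e e01] := @mean_value (fun u => f1 (u + 1) - f1 u)
    (fun u => f2 (u + 1) - f2 u) c.
  move=> t t01; apply: is_deriveB; last by apply: d2; lra.
  by apply: is_derive_translate; apply: d2; lra.
move=> E2.
have [|k k01 E3] := @mean_value f2 f3 e.
  by move=> t t01; apply: d3; lra.
have e12 : (1 + 2 = 3 :> R) by ring.
have e11 : (1 + 1 = 2 :> R) by ring.
have ec : c + 1 + 1 = c + 2 by ring.
move: E1 E2; rewrite /= ?add0r ?e12 ?e11 ?ec => E1 E2.
have -> : f 3 - 3 * f 2 + 3 * f 1 - f 0 = f3 k by lra.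
by apply: fB; lra.
Qed.

Lemma is_derive_term (p s : R -> R) (dp ds t : R) n :
  is_derive t 1 p dp -> is_derive t 1 s ds ->
  is_derive t 1 (fun u => p u * s u ^+ n)
    (p t * (n%:R * s t ^+ n.-1 * ds) + s t ^+ n * dp).
Proof.
move=> hp hs; have := is_deriveM hp (is_deriveX n hs).
rewrite /GRing.scale/= (_ : p * s ^+ n = fun u => p u * s u ^+ n) ?exprfctE//.
Qed.

Lemma is_derive_mul (p s : R -> R) (dp ds t : R) :
  is_derive t 1 p dp -> is_derive t 1 s ds ->
  is_derive t 1 (fun u => p u * s u) (p t * ds + s t * dp).
Proof. by move=> hp hs; exact: (is_deriveM hp hs). Qed.

Lemma is_derive_affine (a b t : R) : is_derive t 1 (fun u => a + b * u) b.
Proof.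
have h := is_deriveD (is_derive_cst a t (1 : R))
  (is_deriveZ b (is_derive_id t (1 : R))).
by rewrite add0r /GRing.scale/= mulr1 in h.
Qed.

Lemma is_derive_inv_sqrt (A B C t : R) : 0 < A + 2 * B * t + C * t ^+ 2 ->
  is_derive t 1 (fun u => (Num.sqrt (A + 2 * B * u + C * u ^+ 2))^-1)
    (- (B + C * t) * (Num.sqrt (A + 2 * B * t + C * t ^+ 2))^-1 ^+ 3).
Proof.
move=> q0.
have hq : is_derive t 1 (fun u => A + 2 * B * u + C * u ^+ 2) (2 * (B + C * t)).
  have h := is_deriveD (is_derive_affine A (2 * B) t)
    (is_derive_term 2 (is_derive_cst C t (1 : R)) (is_derive_id t (1 : R))).
  by apply: (is_derive_eq h); rewrite /=; ring.
have s0 : Num.sqrt (A + 2 * B * t + C * t ^+ 2) != 0 by rewrite gt_eqF// sqrtr_gt0.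
have hs := @is_derive1_comp R Num.sqrt (fun u => A + 2 * B * u + C * u ^+ 2) t
  _ _ (is_derive1_sqrt q0) hq.
have h := @is_deriveV R (Num.sqrt \o (fun u => A + 2 * B * u + C * u ^+ 2)) t _ 1 s0 hs.
by apply: (is_derive_eq h); rewrite /GRing.scale/=; field.
Qed.

(** [- kern] is the vertical derivative of [1 / |a|]. *)
Definition kern (a : R3 R) : R := a.2 / enorm a ^+ 3.

Lemma enorm_coord2 (a : R3 R) : `|a.2| <= enorm a.
Proof.
apply: ler_sqrP; first exact: enorm_ge0.
by rewrite -normrX ger0_norm ?sqr_ge0// sqr_enorm sqnE lerDr addr_ge0 ?sqr_ge0.
Qed.

Lemma kern_le (a : R3 R) : `|kern a| <= (sqn a)^-1.
Proof.
rewrite /kern normrM -sqr_enorm normfV (ger0_norm (exprn_ge0 _ (enorm_ge0 a))).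
have [->|a0] := eqVneq (enorm a) 0; first by rewrite !expr0n/= invr0 mulr0.
have p0 : 0 < enorm a by rewrite lt_neqAle eq_sym a0 enorm_ge0.
rewrite ler_pdivrMr ?exprn_gt0//.
have -> : (enorm a ^+ 2)^-1 * enorm a ^+ 3 = enorm a by field.
exact: enorm_coord2.
Qed.

Definition diff3 (a h : R3 R) : R :=
  kern (a + (3 : R) *: h) - 3 * kern (a + (2 : R) *: h) +
  3 * kern (a + (1 : R) *: h) - kern a.

(** Along [t |-> a + t h] the kernel is [l s^3], with [l] affine and [s] the
    inverse of the square root of a quadratic polynomial.  Each derivative is a
    polynomial combination of [l], [b = (|a + t h|^2)' / 2] and odd powers of [s];
    the third one is at most [(9 + 45 + 45 + 105) |h|^3 s^5].  On the segment,
    [|a + t h| >= |a| / 4], which costs the factor [4^5 = 1024]. *)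
Lemma diff3_le (a h : R3 R) : 4 * enorm h <= enorm a -> 0 < enorm a ->
  `|diff3 a h| <= 204 * 1024 * (enorm h ^+ 3 / enorm a ^+ 5).
Proof.
move=> ha a0.
set A := sqn a; set B := dot a h; set C := sqn h.
pose q t := A + 2 * B * t + C * t ^+ 2.
have qE t : q t = sqn (a + t *: h).
  rewrite sqnD sqnZ /q /A /B /C /dot (_ : (t *: h).1.1 = t * h.1.1)//.
  by rewrite (_ : (t *: h).1.2 = t * h.1.2)// (_ : (t *: h).2 = t * h.2)//; ring.
pose s t := (Num.sqrt (q t))^-1.
have sE t : s t = (enorm (a + t *: h))^-1 by rewrite /s qE.
pose l t := a.2 + h.2 * t; pose b t := B + C * t.
have rho_ge t : 0 <= t <= 3 -> enorm a / 4 <= enorm (a + t *: h).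
  move=> /andP[t0 t3]; have := enormD (a + t *: h) (- (t *: h)).
  rewrite addrK enormN enormZ ger0_norm//.
  have : t * enorm h <= 3 * enorm h by rewrite ler_wpM2r ?enorm_ge0.
  by lra.
have q0 t : 0 <= t <= 3 -> 0 < q t.
  move=> t3; rewrite qE -sqr_enorm exprn_gt0// (lt_le_trans _ (rho_ge t t3))//.
  by rewrite divr_gt0.
have ds t : 0 <= t <= 3 -> is_derive t 1 s (- b t * s t ^+ 3).
  by move=> t3; exact: (is_derive_inv_sqrt (q0 t t3)).
have dl t : is_derive t 1 l h.2 by exact: is_derive_affine.
have db t : is_derive t 1 b C by exact: is_derive_affine.
pose P2 t := (- 3 * l t) * b t.
pose P3 t := (- 6 * h.2) * b t + (- 3 * C) * l t.
pose P4 t := (15 * l t) * (b t * b t).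
have dZ (k : R) (f : R -> R) (d t : R) : is_derive t 1 f d -> is_derive t 1 (fun u => k * f u) (k * d).
  by move=> hf; exact: (is_deriveZ k hf).
have dP2 t : is_derive t 1 P2 (- 3 * (h.2 * b t + l t * C)).
  by apply: (is_derive_eq (is_derive_mul (dZ (- 3) _ _ _ (dl t)) (db t))); ring.
have dP3 t : is_derive t 1 P3 (- 9 * h.2 * C).
  by apply: (is_derive_eq (is_deriveD (dZ (- 6 * h.2) _ _ _ (db t)) (dZ (- 3 * C) _ _ _ (dl t)))); ring.
have dP4 t : is_derive t 1 P4 (15 * h.2 * b t ^+ 2 + 30 * l t * b t * C).
  by apply: (is_derive_eq (is_derive_mul (dZ 15 _ _ _ (dl t)) (is_derive_mul (db t) (db t)))); ring.
pose f t := l t * s t ^+ 3.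
pose f1 t := h.2 * s t ^+ 3 + P2 t * s t ^+ 5.
pose f2 t := P3 t * s t ^+ 5 + P4 t * s t ^+ 7.
pose f3 t := - 9 * h.2 * C * s t ^+ 5 + 45 * h.2 * b t ^+ 2 * s t ^+ 7 +
  45 * l t * b t * C * s t ^+ 7 - 105 * l t * b t ^+ 3 * s t ^+ 9.
have d1 t : 0 <= t <= 3 -> is_derive t 1 f (f1 t).
  move=> t3; apply: (is_derive_eq (is_derive_term 3 (dl t) (ds t t3))).
  by rewrite /f1 /P2/=; ring.
have d2 t : 0 <= t <= 3 -> is_derive t 1 f1 (f2 t).
  move=> t3.
  apply: (is_derive_eq (is_deriveD (is_derive_term 3 (is_derive_cst h.2 t (1 : R)) (ds t t3))
    (is_derive_term 5 (dP2 t) (ds t t3)))).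
  by rewrite /f2 /P2 /P3 /P4/=; ring.
have d3 t : 0 <= t <= 3 -> is_derive t 1 f2 (f3 t).
  move=> t3.
  apply: (is_derive_eq (is_deriveD (is_derive_term 5 (dP3 t) (ds t t3))
    (is_derive_term 7 (dP4 t) (ds t t3)))).
  by rewrite /f3 /P3 /P4/=; ring.
have fE t : f t = kern (a + t *: h).
  by rewrite /f /kern sE exprVn /l; congr (_ / _); rewrite mulrC.
have -> : diff3 a h = f 3 - 3 * f 2 + 3 * f 1 - f 0.
  by rewrite !fE scale0r addr0.
apply: (third_difference_le d1 d2 d3) => t t3.
set rho := enorm (a + t *: h); have rhoa := rho_ge t t3.
have rho0 : 0 < rho by rewrite (lt_le_trans _ rhoa)// divr_gt0.
set eta := enorm h; have eta0 : 0 <= eta by exact: enorm_ge0.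
have lb : `|l t| <= rho.
  by rewrite /l mulrC; exact: (enorm_coord2 (a + t *: h)).
have hb : `|h.2| <= eta by exact: enorm_coord2.
have bb : `|b t| <= eta * rho.
  have bE : b t = dot h (a + t *: h).
    rewrite /b /B /C /sqn /dot (_ : (a + t *: h).1.1 = a.1.1 + t * h.1.1)//.
    rewrite (_ : (a + t *: h).1.2 = a.1.2 + t * h.1.2)//.
    by rewrite (_ : (a + t *: h).2 = a.2 + t * h.2)//; ring.
  rewrite ler_norml bE dot_le andbT lerNl.
  have -> : - dot h (a + t *: h) = dot (- h) (a + t *: h).
    by rewrite /dot (_ : (- h).1.1 = - h.1.1)// (_ : (- h).1.2 = - h.1.2)// (_ : (- h).2 = - h.2)//; ring.
  by rewrite /eta -enormN dot_le.
have CE : C = eta ^+ 2 by rewrite sqr_enorm.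
have sr : s t = rho^-1 by rewrite sE.
have s0 : 0 <= rho^-1 by rewrite invr_ge0 ltW.
set k := rho^-1 in sr s0 *.
have k1 : rho * k = 1 by rewrite mulfV// gt_eqF.
have lk : `|l t| * k <= 1 by rewrite -k1 ler_wpM2r.
have bk : `|b t| * k <= eta by rewrite -[leRHS]mulr1 -k1 mulrA ler_wpM2r.
have lk0 : 0 <= `|l t| * k by rewrite mulr_ge0.
have bk0 : 0 <= `|b t| * k by rewrite mulr_ge0.
have k5 : 0 <= k ^+ 5 by rewrite exprn_ge0.
have bk2 : (`|b t| * k) ^+ 2 <= eta ^+ 2 by rewrite lerXn2r// nnegrE.
have bk3 : (`|b t| * k) ^+ 3 <= eta ^+ 3 by rewrite lerXn2r// nnegrE.
have nk n : `|k ^+ n| = k ^+ n by rewrite ger0_norm// exprn_ge0.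
have h1 : `|- 9 * h.2 * C * s t ^+ 5| <= 9 * (eta ^+ 3 * k ^+ 5).
  rewrite sr CE 3!normrM normrN normr_nat nk normrX (ger0_norm eta0).
  rewrite (_ : 9 * (eta ^+ 3 * k ^+ 5) = 9 * eta * eta ^+ 2 * k ^+ 5); last by ring.
  by rewrite ler_wpM2r// ler_wpM2r ?exprn_ge0// ler_wpM2l.
have h2 : `|45 * h.2 * b t ^+ 2 * s t ^+ 7| <= 45 * (eta ^+ 3 * k ^+ 5).
  rewrite sr 3!normrM normr_nat nk normrX.
  rewrite (_ : _ * k ^+ 7 = 45 * (`|h.2| * (`|b t| * k) ^+ 2 * k ^+ 5)); last by ring.
  by rewrite ler_wpM2l// ler_wpM2r// (exprS eta 2) ler_pM ?exprn_ge0.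
have h3 : `|45 * l t * b t * C * s t ^+ 7| <= 45 * (eta ^+ 3 * k ^+ 5).
  rewrite sr CE 4!normrM normr_nat nk normrX (ger0_norm eta0).
  rewrite (_ : _ * k ^+ 7 = 45 * ((`|l t| * k) * ((`|b t| * k) * eta ^+ 2) * k ^+ 5)); last by ring.
  rewrite ler_wpM2l// ler_wpM2r// -[leRHS]mul1r ler_pM ?mulr_ge0 ?exprn_ge0//.
  by rewrite (exprS eta 2) ler_wpM2r ?exprn_ge0.
have h4 : `|105 * l t * b t ^+ 3 * s t ^+ 9| <= 105 * (eta ^+ 3 * k ^+ 5).
  rewrite sr 3!normrM normr_nat nk normrX.
  rewrite (_ : _ * k ^+ 9 = 105 * ((`|l t| * k) * (`|b t| * k) ^+ 3 * k ^+ 5)); last by ring.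
  by rewrite ler_wpM2l// ler_wpM2r// -[leRHS]mul1r ler_pM ?exprn_ge0.
have : `|f3 t| <= 204 * (eta ^+ 3 * k ^+ 5).
  rewrite /f3; apply: le_trans (ler_normB _ _) _.
  have := ler_normD (- 9 * h.2 * C * s t ^+ 5 + 45 * h.2 * b t ^+ 2 * s t ^+ 7) (45 * l t * b t * C * s t ^+ 7).
  have := ler_normD (- 9 * h.2 * C * s t ^+ 5) (45 * h.2 * b t ^+ 2 * s t ^+ 7).
  by lra.
move=> h5; apply: (le_trans h5).
have : k ^+ 5 <= 1024 * enorm a ^- 5.
  rewrite /k exprVn (_ : 1024 * enorm a ^- 5 = (enorm a / 4) ^- 5); last first.
    by field; rewrite gt_eqF.
  rewrite lef_pV2 ?posrE ?exprn_gt0 ?divr_gt0//.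
  by rewrite lerXn2r// nnegrE ?divr_ge0 ?ltW.
have : 0 <= eta ^+ 3 by rewrite exprn_ge0.
nra.
Qed.

End third_difference.

(** * Difference quotients of the Newtonian potential *)

Section newton_quotient.
Variable R : realType.
Implicit Types (a b x y : R3 R) (t : R).

Definition newton a : R := (enorm a)^-1.

Lemma newton_ge0 a : 0 <= newton a. Proof. by rewrite invr_ge0 enorm_ge0. Qed.

Lemma newton_sqr a : newton a ^+ 2 = (sqn a)^-1.
Proof. by rewrite /newton exprVn sqr_enorm. Qed.

Definition e3 : R3 R := (0, 0, 1).

Lemma sqnDe3 a t : sqn (a + t *: e3) = sqn a + 2 * a.2 * t + t ^+ 2.
Proof.
rewrite sqnD sqnZ /dot (_ : (t *: e3).1.1 = t * 0)// (_ : (t *: e3).1.2 = t * 0)//.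
by rewrite (_ : (t *: e3).2 = t * 1)// [sqn e3]sqnE /=; ring.
Qed.

Lemma enorm_te3 t : enorm (t *: e3) = `|t|.
Proof.
rewrite enormZ (_ : enorm e3 = 1) ?mulr1// /enorm /dot /=.
by rewrite !mulr0 !add0r mulr1 sqrtr1.
Qed.

Lemma enorm_shift_le a t : `|enorm (a + t *: e3) - enorm a| <= `|t|.
Proof.
have h1 := enormD a (t *: e3).
have := enormD (a + t *: e3) (- (t *: e3)); rewrite addrK enormN.
rewrite enorm_te3 in h1 *; rewrite ler_norml; lra.
Qed.

(** For the quotient alone, [|1/q - 1/p| <= |t| / (p q)] with [p = |a|] and
    [q = |a + t e3|], and [1 / (p q)] is at most [p^-2 + q^-2].  The points
    [p = 0] and [q = 0] are covered by [0^-1 = 0]. *)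
Lemma newton_quotient_near a t : t != 0 ->
  `|t^-1 * (newton (a + t *: e3) - newton a) + kern a| <=
  2 * (sqn a)^-1 + (sqn (a + t *: e3))^-1.
Proof.
move=> t0; apply: le_trans (ler_normD _ _) _.
have k1 := kern_le a.
suff : `|t^-1 * (newton (a + t *: e3) - newton a)| <=
    (sqn a)^-1 + (sqn (a + t *: e3))^-1 by lra.
have d := enorm_shift_le a t.
rewrite -!newton_sqr /newton.
move: (enorm_ge0 a) (enorm_ge0 (a + t *: e3)) d.
move: (enorm a) (enorm (a + _)) => p q p0 q0 d.
have t1 : 0 < `|t| by rewrite normr_gt0.
rewrite normrM normfV mulrC ler_pdivrMr//.
have [p00|p1] := eqVneq p 0.
  move: d; rewrite p00 invr0 !subr0 expr0n/= add0r normfV (ger0_norm q0).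
  have [->|q1] := eqVneq q 0; first by rewrite invr0 expr0n mul0r.
  move=> qt; have q2 : 0 < q by rewrite lt_neqAle eq_sym q1.
  rewrite expr2 -mulrA; apply: ler_peMr; first by rewrite invr_ge0.
  by rewrite ler_pdivlMl// mulr1.
have {}p0 : 0 < p by rewrite lt_neqAle eq_sym p1.
have [q00|q1] := eqVneq q 0.
  move: d; rewrite q00 invr0 sub0r normrN expr0n/= addr0 sub0r normrN normfV gtr0_norm//.
  move=> qt; rewrite expr2 -mulrA; apply: ler_peMr; first by rewrite invr_ge0 ltW.
  by rewrite ler_pdivlMl// mulr1.
have {}q0 : 0 < q by rewrite lt_neqAle eq_sym q1.
have -> : q^-1 - p^-1 = (p - q) * (p^-1 * q^-1) by field; rewrite p1 q1.
rewrite normrM [X in _ * X]ger0_norm; last by rewrite mulr_ge0// invr_ge0 ltW.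
rewrite distrC in d.
apply: (@le_trans _ _ (`|t| * (p^-1 * q^-1))).
  by rewrite ler_wpM2r// mulr_ge0// invr_ge0 ltW.
rewrite mulrC ler_wpM2r//.
by have := sqr_ge0 (p^-1 - q^-1); have := sqr_ge0 (p^-1 + q^-1); nra.
Qed.

(** The error of the difference quotient is of relative size [|t| / |a|].  It is
    exact algebra in [p = |a|] and [q = |a + t e3|], linked by
    [q^2 = p^2 + 2 a_3 t + t^2]. *)
Lemma newton_quotient_far a t : t != 0 -> 2 * `|t| <= enorm a -> 0 < enorm a ->
  `|t^-1 * (newton (a + t *: e3) - newton a) + kern a| <=
  6 * (`|t| / enorm a) * (sqn a)^-1.
Proof.
move=> t0 ta p0.
have d := enorm_shift_le a t.
have q2 : enorm (a + t *: e3) ^+ 2 = enorm a ^+ 2 + 2 * a.2 * t + t ^+ 2.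
  by rewrite !sqr_enorm sqnDe3.
have az := enorm_coord2 a.
rewrite -sqr_enorm /newton /kern; move: q2 az ta p0 d.
move: (enorm a) (enorm (a + _)) a.2 => p q z q2 az ta p0 d.
have t1 : 0 < `|t| by rewrite normr_gt0.
have qp : p / 2 <= q by move: d; rewrite ler_norml => /andP[]; lra.
have q0 : 0 < q by rewrite (lt_le_trans _ qp)// divr_gt0.
have pq0 : 0 < p ^+ 3 * (q * (p + q)) by rewrite !mulr_gt0 ?exprn_gt0 ?addr_gt0.
have -> : t^-1 * (q^-1 - p^-1) + z / p ^+ 3 =
    (z * (q * p + q ^+ 2 - 2 * p ^+ 2) - t * p ^+ 2) / (p ^+ 3 * (q * (p + q))).
  have -> : t^-1 * (q^-1 - p^-1) = - (2 * z + t) / (p * q * (p + q)).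
    apply: (mulfI t0); rewrite mulrA mulfV// mul1r.
    have -> : q^-1 - p^-1 = - (q ^+ 2 - p ^+ 2) / (p * q * (p + q)).
      by field; rewrite !gt_eqF ?addr_gt0.
    rewrite q2; field; rewrite !gt_eqF ?addr_gt0//.
  by field; rewrite !gt_eqF ?addr_gt0.
rewrite normrM normfV (gtr0_norm pq0) ler_pdivrMr//.
have -> : 6 * (`|t| / p) * (p ^+ 2)^-1 * (p ^+ 3 * (q * (p + q))) =
    6 * `|t| * q * (p + q) by field; rewrite gt_eqF.
apply: le_trans (ler_normB _ _) _.
rewrite normrM (normrM t) [`|p ^+ 2|]ger0_norm ?sqr_ge0//.
have -> : q * p + q ^+ 2 - 2 * p ^+ 2 = (q - p) * (q + 2 * p) by ring.
rewrite normrM [`|q + 2 * p|]ger0_norm; last by lra.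
apply: (@le_trans _ _ (p * (`|t| * (q + 2 * p)) + `|t| * p ^+ 2)).
  rewrite lerD2r ler_pM ?mulr_ge0//; first by lra.
  by rewrite ler_wpM2r//; lra.
rewrite (_ : p * _ + _ = `|t| * (p * (q + 3 * p))); last by ring.
rewrite (_ : 6 * _ * _ * _ = `|t| * (6 * q * (p + q))); last by ring.
rewrite ler_wpM2l//; nra.
Qed.

End newton_quotient.

Section integrability.
Variable R : realType.
Implicit Types (f F : R3 R -> R).

Lemma integrable_le f F : measurable_fun setT f -> mnn F ->
  {ae leb3, forall y, `|f y| <= F y} -> (I3 F < +oo)%E ->
  leb3.-integrable setT (EFin \o f).
Proof.
move=> mf F0 fF Foo; apply/integrableP; split; first exact: measurableT_comp.
apply: le_lt_trans Foo.
have f0 : mnn (fun y => `|f y|) by split => //; exact: measurableT_comp.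
exact: (I3_ae_le f0 F0 fF).
Qed.

Lemma Rintegral_le f F : measurable_fun setT f -> mnn F ->
  {ae leb3, forall y, `|f y| <= F y} -> (I3 F < +oo)%E ->
  (`|\int[leb3]_y f y|%:E <= I3 F)%E.
Proof.
move=> mf F0 fF Foo; have fi := integrable_le mf F0 fF Foo.
apply: (@le_trans _ _ (I3 (fun y => `|f y|))).
  have f0 : mnn (fun y => `|f y|) by split => //; exact: measurableT_comp.
  have := le_normr_Rintegral measurableT fi.
  rewrite -lee_fin => /le_trans; apply.
  rewrite /Rintegral fineK//; apply: integrable_fin_num => //.
  exact: (integrable_norm fi).
apply: I3_ae_le => //; split => //; exact: measurableT_comp.
Qed.

End integrability.

(** * The vertical derivative of the potential *)

Section potential_derivative.
Variables (R : realType) (g : R3 R -> R) (M L : R).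
Hypotheses (mg : measurable_fun setT g) (M0 : 0 < M) (L0 : 0 < L).
Hypothesis gM : {ae leb3, forall y, `|g y| <= M}.
Hypothesis gL : (I3 (moment g) <= L%:E)%E.
Variable v : R3 R -> R.
Hypotheses (mv : measurable_fun setT v) (vg : forall y, `|v y| <= swirl g y).
Implicit Types (x y : R3 R) (t : R).
Notation mu := (@lebesgue_measure R).

Lemma ae_imp (P Q : R3 R -> Prop) : (forall y, P y -> Q y) ->
  {ae leb3, forall y, P y} -> {ae leb3, forall y, Q y}.
Proof.
move=> PQ [N [mN N0 sub]]; exists N; split=> //; apply: subset_trans sub.
by move=> y /= h Py; apply: h; exact: PQ.
Qed.

Lemma majorant_lty x : (majorant g x < +oo)%E.
Proof. by apply: le_lt_trans (ltry _); exact: (majorant_le mg M0 L0 gM gL x ltr01 ltr01). Qed.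

(** An integrable function that dominates [|x - y|^-2], up to a factor, for [y]
    close to the axis and [|x - y| >= 1]. *)
Definition column x y : R := \1_(`[-1, 1] `*` `[-1, 1]) y.1 * (1 + (x.2 - y.2) ^+ 2)^-1.

Lemma mnn_column x : mnn (column x).
Proof.
split=> [|y]; last first.
  by rewrite mulr_ge0 ?invr_ge0 ?addr_ge0 ?sqr_ge0// indicE.
apply: measurable_funM.
  apply: measurableT_comp => //; apply: measurable_indic.
  by apply: measurableX; exact: measurable_itv.
apply: (measurableT_comp (@measurable_invr R)); apply: measurable_funD => //.
by apply: measurable_funX; apply: measurable_funB.
Qed.

Lemma I3_column x : (I3 (column x) <= 16%:E)%E.
Proof.
have [mc c0] := mnn_column x.
have -> : I3 (column x) = (\int[@leb2 R]_p \int[mu]_z (column x (p, z))%:E)%E.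
  apply: (@fubini_tonelli1 _ _ _ _ _ (@leb2 R) mu (fun y => (column x y)%:E)).
    exact: measurableT_comp.
  by move=> y; rewrite lee_fin.
pose J := (`[- 1, 1] `*` `[- 1, 1] : set (R * R)).
have mJ : measurable J by apply: measurableX; exact: measurable_itv.
apply: (@le_trans _ _ (\int[@leb2 R]_p ((\1_J p)%:E * 4%:E))%E).
  apply: ge0_le_integral => //.
  - by move=> p _; apply: integral_ge0 => z _; rewrite lee_fin.
  - apply: (@measurable_fun_fubini_tonelli_F _ _ _ _ _ mu (fun y => (column x y)%:E)).
      exact: measurableT_comp.
    by move=> y; rewrite lee_fin.
  - by apply: emeasurable_funM => //; apply/measurable_EFinP; exact: measurable_indic.
  move=> p _; rewrite /column/=.
  under eq_integral do rewrite EFinM.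
  rewrite ge0_integralZl_EFin//; last 2 first.
  - by move=> z _; rewrite lee_fin invr_ge0 addr_ge0 ?sqr_ge0.
  - apply: measurableT_comp => //.
    apply: (measurableT_comp (@measurable_invr R)); apply: measurable_funD => //.
    by apply: measurable_funX; apply: measurable_funB.
  apply: lee_wpmul2l; first by rewrite lee_fin indicE.
  have := @integral_lorentz_le R 1 1 x.2 ltr01 ltr01.
  rewrite expr1n mulr1 invr1 mulr1; congr (_ <= _)%E.
  apply: eq_integral => z _; rewrite mul1r -[(z - _) ^+ 2]sqrrN opprB//.
rewrite ge0_integralZr//; last by apply/measurable_EFinP; exact: measurable_indic.
rewrite integral_indic// setIT.
rewrite [X in (X * _)%E](_ : _ = 4%:E); first by rewrite -EFinM lee_fin; lra.
have e := @product_measure1E _ _ _ _ _ mu mu `[- 1, 1] `[- 1, 1]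
  (measurable_itv _) (measurable_itv _).
have I : mu `[- 1, 1] = 2%:E.
  rewrite lebesgue_measure_itv/= lte_fin ifT; last by lra.
  by rewrite -EFinD; congr EFin; ring.
apply: (eq_trans e); apply: (eq_trans (congr2 mule I I)).
by rewrite -EFinM; congr EFin; ring.
Qed.

(** This makes the potential an absolutely convergent integral.  Close to [x],
    [1 / |x - y|] is at most its square.  Far from [x], the density is at most the
    moment where [r_y >= 1]; near the axis, Young's inequality leaves the moment
    and [M |x - y|^-2], which decays along the axis. *)
Lemma newton_swirl_le x y : `|g y| <= M -> newton (x - y) * swirl g y <=
  (sqn (x - y))^-1 * swirl g y + (moment g y + 2 * M * column x y).
Proof.
move=> gy; have c0 := mnn_ge0 y (mnn_column x).
have m0 := mnn_ge0 y (mnn_moment mg).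
have s0 := mnn_ge0 y (mnn_swirl mg).
have Mc0 : 0 <= 2 * M * column x y.
  by apply: mulr_ge0 => //; apply: mulr_ge0 => //; exact: ltW.
have p0 : 0 <= newton (x - y) by exact: newton_ge0.
have [p1|p1] := ltP (enorm (x - y)) 1.
  rewrite -[leLHS]addr0; apply: lerD; last exact: addr_ge0.
  rewrite ler_wpM2r// -newton_sqr expr2.
  have [e0|e0] := eqVneq (enorm (x - y)) 0.
    by rewrite /newton e0 invr0 mulr0.
  have q0 : 0 < enorm (x - y) by rewrite lt_neqAle eq_sym e0 enorm_ge0.
  by apply: ler_peMr => //; rewrite /newton invf_ge1// ltW.
rewrite -[leLHS]add0r; apply: lerD; first by rewrite mulr_ge0 ?invr_ge0 ?sqn_ge0.
have n1 : newton (x - y) <= 1 by rewrite invf_le1// (lt_le_trans _ p1).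
have [r1|r1] := leP 1 (cyl_r y).
  rewrite -[leLHS]addr0; apply: lerD; last exact: Mc0.
  apply: (@le_trans _ _ (swirl g y)); first by rewrite ler_piMl.
  rewrite /swirl /moment -sqr_cyl_r ler_wpM2r// expr2.
  by apply: ler_peMr => //; exact: cyl_r_ge0.
have cE : column x y = (1 + (x.2 - y.2) ^+ 2)^-1.
  rewrite /column indicE mem_set ?mul1r//.
  have : rsq y <= 1 by rewrite -sqr_cyl_r expr_le1// ?cyl_r_ge0// ltW.
  rewrite /rsq => h; have h1 := sqr_ge0 y.1.1; have h2 := sqr_ge0 y.1.2.
  by split; rewrite /= in_itv/=; apply/andP; nra.
have n2 : newton (x - y) ^+ 2 <= 2 * column x y.
  rewrite newton_sqr cE -sqr_enorm.
  have q1 : 1 <= enorm (x - y) ^+ 2 by rewrite exprn_ege1.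
  have q2 : (x.2 - y.2) ^+ 2 <= enorm (x - y) ^+ 2.
    by rewrite sqr_enorm sqnB_rsq lerDr addr_ge0 ?sqr_ge0.
  have h0 : 0 < 1 + (x.2 - y.2) ^+ 2 by rewrite ltr_pwDl ?sqr_ge0.
  by rewrite ler_pdivlMr// ler_pdivrMl; lra.
rewrite /swirl /moment -sqr_cyl_r.
have v0 := normr_ge0 (g y); have r0 := cyl_r_ge0 y.
apply: (@le_trans _ _ (`|g y| * (cyl_r y ^+ 2 + newton (x - y) ^+ 2))).
  rewrite (_ : newton (x - y) * _ = `|g y| * (newton (x - y) * cyl_r y)); last by ring.
  rewrite ler_wpM2l//.
  by have := sqr_ge0 (newton (x - y) - cyl_r y); have := sqr_ge0 (newton (x - y) + cyl_r y); nra.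
rewrite mulrDr; apply: lerD; first by rewrite mulrC.
rewrite (_ : 2 * M * column x y = M * (2 * column x y)); last by ring.
by apply: ler_pM => //; exact: sqr_ge0.
Qed.

Definition potential x : R := \int[leb3]_y (v y / (4 * pi * enorm (x - y))).
Definition kern_conv x : R := \int[leb3]_y (kern (x - y) * v y).

Lemma measurable_kern : measurable_fun setT (@kern R).
Proof.
apply: measurable_funM; first exact: measurable_snd.
apply: (measurableT_comp (@measurable_invr R)); apply: measurable_funX.
exact: measurable_enorm.
Qed.

Lemma measurable_kern_sub x : measurable_fun setT (fun y => kern (x - y) * v y).
Proof.
apply: measurable_funM => //.
exact: (measurableT_comp measurable_kern (measurable_sub x)).
Qed.

Lemma measurable_newton_sub x : measurable_fun setT (fun y => newton (x - y) * v y).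
Proof.
apply: measurable_funM => //.
apply: (measurableT_comp (@measurable_invr R)).
exact: (measurableT_comp (@measurable_enorm R) (measurable_sub x)).
Qed.

Lemma kern_sub_le x y : `|kern (x - y) * v y| <= (sqn (x - y))^-1 * swirl g y.
Proof. by rewrite normrM ler_pM// kern_le. Qed.

Lemma integrable_kern x : leb3.-integrable setT (EFin \o (fun y => kern (x - y) * v y)).
Proof.
apply: (integrable_le (measurable_kern_sub x) (mnn_majorant mg x)).
  by apply: ae_imp gM => y _; exact: kern_sub_le.
exact: majorant_lty.
Qed.

Lemma kern_conv_le x : (`|kern_conv x|%:E <= majorant g x)%E.
Proof.
apply: (Rintegral_le (measurable_kern_sub x) (mnn_majorant mg x)).
  by apply: ae_imp gM => y _; exact: kern_sub_le.
exact: majorant_lty.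
Qed.

Lemma integrable_newton x : leb3.-integrable setT (EFin \o (fun y => newton (x - y) * v y)).
Proof.
have c2 : 0 <= 2 * M by rewrite mulr_ge0// ltW.
have hc := mnnZ c2 (mnn_column x); have hm := mnn_moment mg.
have hw := mnn_majorant mg x.
apply: (integrable_le (measurable_newton_sub x) (mnnD hw (mnnD hm hc))).
  apply: ae_imp gM => y gy; apply: le_trans (newton_swirl_le x gy).
  by rewrite normrM ler_pM// ger0_norm// newton_ge0.
rewrite I3D//; last exact: mnnD.
rewrite I3D// I3Z//; last exact: mnn_column.
apply: lte_add_pinfty; first exact: majorant_lty.
apply: lte_add_pinfty; first exact: le_lt_trans gL (ltry _).
apply: (@le_lt_trans _ _ ((2 * M)%:E * 16%:E)%E); last by rewrite -EFinM ltry.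
by apply: lee_wpmul2l; [rewrite lee_fin|exact: I3_column].
Qed.

Lemma potentialE x : potential x = (4 * pi)^-1 * \int[leb3]_y (newton (x - y) * v y).
Proof.
rewrite -RintegralZl//; last exact: integrable_newton.
by apply: eq_Rintegral => y _; rewrite invfM /newton; ring.
Qed.

Lemma pi4_inv : 0 < (4 * pi : R)^-1 <= 1.
Proof.
have p0 := @pi_gt0 R; have := @pihalf_ge1 R => p1.
by rewrite invr_gt0 mulr_gt0//= invf_le1 ?mulr_gt0//; lra.
Qed.

(** The integral of the error of the difference quotient is split at distance [d]
    from [x], with [|t| <= d^2]: the near part is small because the kernel is
    integrable, the far part because the relative error [6 |t| / |x - y|] is at
    most [6 d]. *)
Lemma potential_quotient_le x (d W t : R) : 0 < d <= 2^-1 -> t != 0 ->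
  `|t| <= d ^+ 2 -> (majorant g x <= W%:E)%E ->
  `|t^-1 * (potential (x + t *: e3 R) - potential x) + (4 * pi)^-1 * kern_conv x|
  <= d * (256 * (cyl_r x + 1) * M + 6 * W).
Proof.
move=> /andP[d0 d2] t0 td xW.
pose x' := x + t *: e3 R.
have x'y y : x' - y = (x - y) + t *: e3 R by rewrite /x' addrAC.
pose D y := (t^-1 * (newton (x' - y) - newton (x - y)) + kern (x - y)) * v y.
have in1 := integrable_newton x'; have in2 := integrable_newton x.
have in3 := integrable_kern x.
have in12 := integrableB measurableT in1 in2.
have E : t^-1 * (potential x' - potential x) + (4 * pi)^-1 * kern_conv x =
    (4 * pi)^-1 * \int[leb3]_y D y.
  rewrite !potentialE -mulrBr mulrCA -mulrDr; congr (_ * _).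
  rewrite -RintegralB// -RintegralZl// -RintegralD//.
    by apply: eq_Rintegral => y _; rewrite /D; ring.
  exact: (integrableZl measurableT t^-1 in12).
rewrite E normrM; have /andP[p0 p1] := pi4_inv.
rewrite gtr0_norm//.
apply: (@le_trans _ _ `|\int[leb3]_y D y|); first by rewrite ler_piMl.
pose a := (cyl_r x + d) * M.
have a0 : 0 <= a by rewrite mulr_ge0 ?addr_ge0 ?cyl_r_ge0// ltW.
pose b := 6 * d.
have b0 : 0 <= b by rewrite mulr_ge0// ltW.
pose F y := a * (2 * near_kernel d (x - y) + near_kernel (2 * d) (x' - y)) +
  b * ((sqn (x - y))^-1 * swirl g y).
have n1 := mnn_sub x (mnn_near d); have n2 := mnn_sub x' (mnn_near (2 * d)).
have n3 := mnnD (mnnZ (ler0n _ 2) n1) n2.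
have n4 := mnn_majorant mg x.
have F0 : mnn F := mnnD (mnnZ a0 n3) (mnnZ b0 n4).
have IF : (I3 F <= (d * (256 * (cyl_r x + 1) * M + 6 * W))%:E)%E.
  rewrite /F I3D ?I3Z//; [|exact: mnnZ|exact: mnnZ].
  rewrite I3D//; last exact: mnnZ.
  rewrite I3Z// (I3_sub _ (mnn_near _)) (I3_sub _ (mnn_near _)).
  have h1 : (2%:E * I3 (near_kernel d) <= (2 * (64 * d))%:E)%E.
    by rewrite (EFinM 2); apply: lee_wpmul2l; [rewrite lee_fin|exact: I3_near].
  have h2 : (I3 (near_kernel (2 * d)) <= (64 * (2 * d))%:E)%E.
    by apply: I3_near; rewrite mulr_gt0.
  have h3 := leeD h1 h2.
  have h4 : (a%:E * (2%:E * I3 (near_kernel d) + I3 (near_kernel (2 * d))) <=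
     (a * (2 * (64 * d) + 64 * (2 * d)))%:E)%E.
    by rewrite (EFinM a); apply: lee_wpmul2l; rewrite ?lee_fin// EFinD.
  have h5 : (b%:E * majorant g x <= (b * W)%:E)%E.
    by rewrite (EFinM b); apply: lee_wpmul2l; rewrite ?lee_fin.
  apply: le_trans (leeD h4 h5) _; rewrite -EFinD lee_fin /a /b.
  have : (cyl_r x + d) * M <= (cyl_r x + 1) * M by rewrite ler_wpM2r ?(ltW M0)//; lra.
  have := ltW d0; nra.
rewrite -lee_fin; apply: le_trans (IF); apply: Rintegral_le => //.
- apply: measurable_funM => //; apply: measurable_funD.
    apply: measurable_funM => //.
    by apply: measurable_funB; apply: (measurableT_comp (@measurable_invr R));
      apply: (measurableT_comp (@measurable_enorm R)); exact: measurable_sub.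
  exact: (measurableT_comp measurable_kern (measurable_sub x)).
- apply: ae_imp gM => y gy; rewrite /D normrM.
  have s0 := mnn_ge0 y (mnn_swirl mg).
  have q0 : 0 <= (sqn (x - y))^-1 by rewrite invr_ge0 sqn_ge0.
  have td2 : 2 * `|t| <= d by apply: le_trans (ler_wpM2l _ td) _ => //; nra.
  have [pd|pd] := ltP (enorm (x - y)) d.
    rewrite -[leLHS]addr0; apply: lerD; last exact: (mulr_ge0 b0 (mulr_ge0 q0 s0)).
    rewrite mulrC; apply: ler_pM => //.
      apply: le_trans (vg y) _; rewrite /swirl ler_pM ?cyl_r_ge0//.
      by apply: le_trans (cyl_r_triangle x y) _; rewrite lerD2l ltW.
    rewrite x'y; apply: le_trans (newton_quotient_near (x - y) t0) _.
    have d20 : 0 <= 2 * d by rewrite mulr_ge0// ltW.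
    rewrite /near_kernel -(enorm_lt _ (ltW d0)) pd -(enorm_lt _ d20) ifT//.
    by have := enorm_shift_le (x - y) t; rewrite ler_norml => /andP[_]; lra.
  rewrite -[leLHS]add0r; apply: lerD.
    by apply: mulr_ge0 => //; exact: mnn_ge0 n3.
  have p00 : 0 < enorm (x - y) by rewrite (lt_le_trans d0).
  rewrite /b mulrA; apply: ler_pM => //.
  rewrite x'y; apply: le_trans (newton_quotient_far t0 _ p00) _; first by lra.
  rewrite ler_wpM2r// ler_wpM2l// ler_pdivrMr//.
  by apply: le_trans td _; rewrite expr2 ler_wpM2l// ltW.
- exact: le_lt_trans IF (ltry _).
Qed.

Lemma potential_derive x : 'D_(e3 R) potential x = - (4 * pi)^-1 * kern_conv x.
Proof.
have [W xW] : exists W : R, (majorant g x <= W%:E)%E.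
  by eexists; exact: (majorant_le mg M0 L0 gM gL x ltr01 ltr01).
pose K := 256 * (cyl_r x + 1) * M + 6 * W.
have W0 : 0 <= W.
  by rewrite -lee_fin (le_trans _ xW)// I3_ge0//; exact: mnn_majorant.
have K0 : 0 <= K.
  apply: addr_ge0; last by rewrite mulr_ge0.
  by rewrite !mulr_ge0 ?(ltW M0)// addr_ge0 ?cyl_r_ge0.
apply: cvg_lim => //.
apply/cvgrPdist_le => e e0.
(* within |t| <= d^2 the error is at most d K <= e *)
pose d := Num.min 2^-1 (e / (K + 1)).
have K1 : 0 < K + 1 by rewrite ltr_wpDl.
have d0 : 0 < d by rewrite lt_min divr_gt0// andbT invr_gt0.
have d2 : d <= 2^-1 by rewrite ge_min lexx.
have dK : d * K <= e.
  apply: (@le_trans _ _ (e / (K + 1) * (K + 1))); last by rewrite divfK// gt_eqF.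
  by apply: ler_pM => //; [exact: ltW|rewrite ge_min lexx orbT|rewrite lerDl].
near=> t.
have t0 : t != 0 by near: t; exact: nbhs_dnbhs_neq.
have td : `|t| <= d ^+ 2.
  near: t; apply: nbhs_dnbhs; apply/nbhs_ballP; exists (d ^+ 2) => /=.
    by rewrite exprn_gt0.
  by move=> t; rewrite /ball/= sub0r normrN => /ltW.
have d02 : 0 < d <= 2^-1 by rewrite d0.
apply: le_trans dK; apply: le_trans (potential_quotient_le d02 t0 td xW).
rewrite -normrN /shift/= [t *: _ + x]addrC le_eqVlt; apply/orP; left; apply/eqP.
by congr Num.norm; rewrite /GRing.scale/=; ring.
Unshelve. all: by end_near. Qed.

End potential_derivative.

(** * Third differences of the velocity *)

Section third_difference_of_convolution.
Variables (R : realType) (g : R3 R -> R) (M L : R).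
Hypotheses (mg : measurable_fun setT g) (M0 : 0 < M) (L0 : 0 < L).
Hypothesis gM : {ae leb3, forall y, `|g y| <= M}.
Hypothesis gL : (I3 (moment g) <= L%:E)%E.
Implicit Types (x y h : R3 R).

(** A round number above the sum of the constants of the near and far parts. *)
Definition diff3_const : R := 200 * 200 * 200.

Section density.
Variable v : R3 R -> R.
Hypotheses (mv : measurable_fun setT v) (vg : forall y, `|v y| <= swirl g y).

Let ik := integrable_kern mg M0 L0 gM gL mv vg.

Lemma measurable_diff3 x h : measurable_fun setT (fun y => diff3 (x - y) h).
Proof.
have mk (k : R) : measurable_fun setT (fun y => kern (x - y + k *: h)).
  apply: (measurableT_comp (@measurable_kern R)).
  have -> : (fun y => x - y + k *: h) = (fun y => (x + k *: h) - y).
    by apply/funext => y; rewrite addrAC.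
  exact: measurable_sub.
apply: measurable_funB.
  by apply: measurable_funD; [apply: measurable_funB|]; rewrite ?mk//; apply: measurable_funM.
exact: (measurableT_comp (@measurable_kern R) (measurable_sub x)).
Qed.

Lemma kern_conv_comb (p q r s : R3 R) :
  kern_conv v p - 3 * kern_conv v q + 3 * kern_conv v r - kern_conv v s =
  \int[leb3]_y ((kern (p - y) - 3 * kern (q - y) + 3 * kern (r - y) -
    kern (s - y)) * v y).
Proof.
have i2 := integrableZl measurableT 3 (ik q).
have i1 := integrableZl measurableT 3 (ik r).
have i32 := integrableB measurableT (ik p) i2.
have i321 := integrableD measurableT i32 i1.
rewrite /kern_conv -(RintegralZl 3 measurableT (ik q)).
rewrite -(RintegralZl 3 measurableT (ik r)).
rewrite -(RintegralB measurableT (ik p) i2) -(RintegralD measurableT i32 i1).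
rewrite -(RintegralB measurableT i321 (ik s)).
by apply: eq_Rintegral => y _; ring.
Qed.

Lemma kern_conv_diff3E x h :
  kern_conv v (x + (3 : R) *: h) - 3 * kern_conv v (x + (2 : R) *: h) +
  3 * kern_conv v (x + (1 : R) *: h) - kern_conv v x =
  \int[leb3]_y (diff3 (x - y) h * v y).
Proof.
rewrite kern_conv_comb; apply: eq_Rintegral => y _; rewrite /diff3.
have e (k : R) : x - y + k *: h = x + k *: h - y by rewrite addrAC.
by rewrite !e.
Qed.

(** Where [|x - y| < 4 |h|], all four points are within [7 |h|] of [y], and
    cancellation is of no help. *)
Lemma diff3_near x y h : enorm (x - y) < 4 * enorm h ->
  `|diff3 (x - y) h| <= 3 * (near_kernel (7 * enorm h) (x + (3 : R) *: h - y) +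
    near_kernel (7 * enorm h) (x + (2 : R) *: h - y) +
    near_kernel (7 * enorm h) (x + (1 : R) *: h - y) +
    near_kernel (7 * enorm h) (x - y)).
Proof.
move=> xh; have h0 := enorm_ge0 h.
have kn (k : R) : 0 <= k <= 3 -> `|kern (x - y + k *: h)| <=
    near_kernel (7 * enorm h) (x + k *: h - y).
  move=> /andP[k0 k3]; rewrite (_ : x + k *: h - y = x - y + k *: h); last first.
    by rewrite addrAC.
  rewrite /near_kernel -(enorm_lt _ (mulr_ge0 (ler0n _ 7) h0)) ifT ?kern_le//.
  apply: le_lt_trans (enormD _ _) _; rewrite enormZ ger0_norm//.
  have : k * enorm h <= 3 * enorm h by rewrite ler_wpM2r.
  by lra.
have k3 := kn 3 ltac:(lra); have k2 := kn 2 ltac:(lra).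
have k1 := kn 1 ltac:(lra); have k0 := kn 0 ltac:(lra).
rewrite scale0r !addr0 in k0.
rewrite /diff3; move: k0 k1 k2 k3.
move: (kern _) (kern (_ + 1 *: _)) (kern (_ + 2 *: _)) (kern (_ + 3 *: _)) => a b c d.
rewrite !ler_norml; lra.
Qed.

(** Where [|x - y| >= 4 |h|], the kernel decays like [|h|^3 |x - y|^-5] and the
    density is at most [M (r + |x - y|)]; as [|h| / |x - y| <= 1], the product is at
    most [M |h|^2 (r + |h|)] times [|x - y|^-4], which is integrable. *)
Lemma kern_conv_diff3_le x h : 0 < enorm h ->
  `|kern_conv v (x + (3 : R) *: h) - 3 * kern_conv v (x + (2 : R) *: h) +
    3 * kern_conv v (x + (1 : R) *: h) - kern_conv v x| <=
  diff3_const * (M * (enorm h * (cyl_r x + enorm h))).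
Proof.
move=> h0; rewrite kern_conv_diff3E.
set eta := enorm h in h0 *; set r := cyl_r x.
have r0 : 0 <= r by exact: cyl_r_ge0.
(* the numeral is kept abstract, which spares the arithmetic tactics *)
have [K KE] : exists K : R, K = 204 * 1024 by exists (204 * 1024).
have K0 : 0 <= K by lra.
have re0 : 0 <= r + eta by rewrite addr_ge0// ltW.
have re4 : 0 <= r + 4 * eta by have := ltW h0; lra.
have M00 := ltW M0.
pose a := 3 * (M * (r + 4 * eta)).
have a0 : 0 <= a by apply: mulr_ge0 => //; exact: mulr_ge0.
pose b := K * (M * (eta ^+ 2 * (r + eta))).
have b0 : 0 <= b.
  apply: mulr_ge0 => //; apply: mulr_ge0 => //; apply: mulr_ge0 => //.
  exact: sqr_ge0.
pose nk (k : R) y := near_kernel (7 * eta) (x + k *: h - y).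
have nk0 (k : R) : mnn (nk k) := mnn_sub (x + k *: h) (mnn_near _).
pose n0 y := near_kernel (7 * eta) (x - y).
have n00 : mnn n0 := mnn_sub x (mnn_near _).
have f0 := mnn_sub x (mnn_far (4 * eta)).
pose F y := a * (nk 3 y + nk 2 y + nk 1 y + n0 y) + b * far_kernel (4 * eta) (x - y).
have s0 := mnnD (mnnD (mnnD (nk0 3) (nk0 2)) (nk0 1)) n00.
have F0 : mnn F := mnnD (mnnZ a0 s0) (mnnZ b0 f0).
have eta7 : 0 < 7 * eta by rewrite mulr_gt0.
have eta4 : 0 < 4 * eta by rewrite mulr_gt0.
have IF : (I3 F <= (diff3_const * (M * (eta * (r + eta))))%:E)%E.
  rewrite /F I3D ?I3Z//; [|exact: mnnZ|exact: mnnZ].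
  rewrite I3D//; last by apply: mnnD => //; exact: mnnD.
  rewrite I3D//; last exact: mnnD.
  rewrite I3D// /nk /n0 !(I3_sub _ (mnn_near _)) (I3_sub _ (mnn_far _)).
  have h1 := I3_near eta7; have h2 := I3_far eta4.
  have h4 : (a%:E * (I3 (near_kernel (7 * eta)) + I3 (near_kernel (7 * eta)) +
      I3 (near_kernel (7 * eta)) + I3 (near_kernel (7 * eta))) <=
      (a * (4 * (64 * (7 * eta))))%:E)%E.
    rewrite (EFinM a); apply: lee_wpmul2l; first by rewrite lee_fin.
    apply: le_trans (leeD (leeD (leeD h1 h1) h1) h1) _.
    by rewrite -!EFinD lee_fin; lra.
  have h5 : (b%:E * I3 (far_kernel (4 * eta)) <= (b * (128 / (4 * eta)))%:E)%E.
    by rewrite (EFinM b); apply: lee_wpmul2l; rewrite ?lee_fin.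
  apply: le_trans (leeD h4 h5) _; rewrite -EFinD lee_fin /a /b /diff3_const.
  have -> : K * (M * (eta ^+ 2 * (r + eta))) * (128 / (4 * eta)) =
      K * 32 * (M * (eta * (r + eta))) by field; rewrite gt_eqF.
  have p1 : 0 <= M * (eta * r) by rewrite !mulr_ge0// ltW.
  have p2 : 0 <= M * (eta * eta) by rewrite !mulr_ge0// ltW.
  rewrite (_ : 3 * (M * (r + 4 * eta)) * _ = 3 * 4 * 64 * 7 * (M * (eta * r) + 4 * (M * (eta * eta)))); last by ring.
  rewrite (_ : M * (eta * (r + eta)) = M * (eta * r) + M * (eta * eta)); last by ring.
  by rewrite KE; lra.
rewrite -lee_fin; apply: le_trans (IF); apply: Rintegral_le => //.
- by apply: measurable_funM => //; exact: measurable_diff3.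
- apply: ae_imp gM => y gy; rewrite normrM.
  have rt := cyl_r_triangle x y; rewrite -/r in rt.
  have [xh|xh] := ltP (enorm (x - y)) (4 * eta).
    rewrite -[leLHS]addr0; apply: lerD; last exact: (mulr_ge0 b0 (mnn_ge0 y f0)).
    apply: (@le_trans _ _ (3 * (nk 3 y + nk 2 y + nk 1 y + n0 y) * ((r + 4 * eta) * M))).
      apply: ler_pM => //; first exact: diff3_near.
      apply: le_trans (vg y) _; apply: ler_pM => //; first exact: cyl_r_ge0.
      by lra.
    by rewrite le_eqVlt; apply/orP; left; apply/eqP; rewrite /a; ring.
  rewrite -[leLHS]add0r; apply: lerD; first exact: (mulr_ge0 a0 (mnn_ge0 y s0)).
  have p0 : 0 < enorm (x - y) by rewrite (lt_le_trans eta4).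
  have fE : far_kernel (4 * eta) (x - y) = enorm (x - y) ^- 4.
    rewrite /far_kernel ifT -?sqr_enorm -?exprM//.
    by rewrite lerXn2r ?nnegrE ?enorm_ge0// ltW.
  rewrite fE.
  apply: (@le_trans _ _ (K * (eta ^+ 3 / enorm (x - y) ^+ 5) *
    ((r + enorm (x - y)) * M))).
    apply: ler_pM => //; first by rewrite KE; exact: diff3_le.
    by apply: le_trans (vg y) _; apply: ler_pM => //; exact: cyl_r_ge0.
  move: (enorm (x - y)) p0 xh => p p0 xh.
  rewrite (_ : _ * _ = K * M * eta ^+ 2 * p ^- 4 * ((eta / p) * (r + p))); last first.
    by field; rewrite gt_eqF.
  rewrite (_ : b * p ^- 4 = K * M * eta ^+ 2 * p ^- 4 * (r + eta)); last first.
    by rewrite /b; field; rewrite gt_eqF.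
  apply: ler_wpM2l.
    apply: mulr_ge0; last by rewrite invr_ge0 exprn_ge0// ltW.
    by apply: mulr_ge0; [exact: mulr_ge0|exact: sqr_ge0].
  rewrite mulrDr divfK ?gt_eqF// lerD2r ler_piMl// ler_pdivrMr// mul1r.
  by apply: le_trans xh; lra.
- exact: le_lt_trans IF (ltry _).
Qed.

End density.

End third_difference_of_convolution.

(** * Bounds on the horizontal velocity *)

Section velocity_estimates.
Variables (R : realType) (g : R3 R -> R) (M L : R).
Hypotheses (mg : measurable_fun setT g) (M0 : 0 < M) (L0 : 0 < L).
Hypothesis gM : {ae leb3, forall y, `|g y| <= M}.
Hypothesis gL : (I3 (moment g) <= L%:E)%E.
Hypothesis ginv : rot_invariant g.
Implicit Types (x y h : R3 R).

Definition density1 y : R := y.1.1 * g y.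
Definition density2 y : R := y.1.2 * g y.

Lemma measurable_density1 : measurable_fun setT density1.
Proof. by apply: measurable_funM => //; exact: measurableT_comp. Qed.

Lemma measurable_density2 : measurable_fun setT density2.
Proof. by apply: measurable_funM => //; exact: measurableT_comp. Qed.

Lemma density1_le y : `|density1 y| <= swirl g y.
Proof.
rewrite /density1 /swirl normrM ler_wpM2r//; apply: ler_sqrP; first exact: cyl_r_ge0.
by rewrite sqr_cyl_r -normrX ger0_norm ?sqr_ge0// lerDl sqr_ge0.
Qed.

Lemma density2_le y : `|density2 y| <= swirl g y.
Proof.
rewrite /density2 /swirl normrM ler_wpM2r//; apply: ler_sqrP; first exact: cyl_r_ge0.
by rewrite sqr_cyl_r -normrX ger0_norm ?sqr_ge0// lerDr sqr_ge0.
Qed.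

(** The pair [(vel1, vel2)] is [4 pi] times the horizontal velocity. *)
Definition vel1 x : R := kern_conv density1 x.
Definition vel2 x : R := kern_conv density2 x.
Definition sqr_speed x : R := vel1 x ^+ 2 + vel2 x ^+ 2.

Lemma Rintegral_scales (phi : R3 R -> R3 R) (f : R3 R -> R) :
  scales leb3 phi 1 -> measurable_fun setT f ->
  \int[leb3]_x f (phi x) = \int[leb3]_x f x.
Proof.
move=> [_ _ sphi] mf; have mf' : measurable_fun setT (EFin \o f) by exact: measurableT_comp.
rewrite /Rintegral; congr fine; rewrite integralE [RHS]integralE.
congr (_ - _)%E.
- rewrite -[RHS]mul1e -sphi; [|exact: measurable_funepos|by move=> x; exact: funepos_ge0].
  by apply: eq_integral => y _; rewrite !unlock.
- rewrite -[RHS]mul1e -sphi; [|exact: measurable_funeneg|by move=> x; exact: funeneg_ge0].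
  by apply: eq_integral => y _; rewrite !unlock.
Qed.

Lemma kern_rot (c s : R) x y : c ^+ 2 + s ^+ 2 = 1 ->
  kern (rot c s x - rot c s y) = kern (x - y).
Proof.
move=> cs; rewrite /kern; congr (_ / _ ^+ _); rewrite /enorm; congr Num.sqrt.
rewrite -!/(sqn _) !sqnB_rsq !rsqB /rot/=; congr (_ + _).
transitivity ((c ^+ 2 + s ^+ 2) * ((x.1.1 - y.1.1) ^+ 2 + (x.1.2 - y.1.2) ^+ 2)).
  by ring.
by rewrite cs mul1r.
Qed.

Lemma kern_conv_rot (v : R3 R -> R) (c s a b : R) x : 0 < c -> c ^+ 2 + s ^+ 2 = 1 ->
  measurable_fun setT v ->
  (forall y, v (rot c s y) = a * density1 y + b * density2 y) ->
  kern_conv v (rot c s x) = a * vel1 x + b * vel2 x.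
Proof.
move=> c0 cs mv vrot.
rewrite /kern_conv -(Rintegral_scales (scales3_rot c0 cs)); last first.
  apply: measurable_funM => //.
  exact: (measurableT_comp (@measurable_kern R) (measurable_sub _)).
have i1 := integrable_kern mg M0 L0 gM gL measurable_density1 density1_le x.
have i2 := integrable_kern mg M0 L0 gM gL measurable_density2 density2_le x.
rewrite /vel1 /vel2 /kern_conv -!RintegralZl//.
rewrite -RintegralD//; [|exact: (integrableZl measurableT a i1)|exact: (integrableZl measurableT b i2)].
apply: eq_Rintegral => y _; rewrite kern_rot// vrot; ring.
Qed.

(** The pair of densities turns with the point, hence so does the pair of
    velocities, and its length is unchanged. *)
Lemma sqr_speed_rot_invariant : rot_invariant sqr_speed.
Proof.
move=> c s x c0 cs; rewrite /sqr_speed.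
have e1 : vel1 (rot c s x) = c * vel1 x + (- s) * vel2 x.
  apply: kern_conv_rot => //; first exact: measurable_density1.
  by move=> y; rewrite /density1 /density2 ginv// /rot/=; ring.
have e2 : vel2 (rot c s x) = s * vel1 x + c * vel2 x.
  apply: kern_conv_rot => //; first exact: measurable_density2.
  by move=> y; rewrite /density1 /density2 ginv// /rot/=; ring.
rewrite e1 e2.
transitivity ((c ^+ 2 + s ^+ 2) * (vel1 x ^+ 2 + vel2 x ^+ 2)); first by ring.
by rewrite cs mul1r.
Qed.

Lemma sqr_speed_le_majorant (B : R) x : (majorant g x <= B%:E)%E -> sqr_speed x <= 2 * B ^+ 2.
Proof.
move=> xB.
have h1 := le_trans (kern_conv_le mg M0 L0 gM gL measurable_density1 density1_le x) xB.
have h2 := le_trans (kern_conv_le mg M0 L0 gM gL measurable_density2 density2_le x) xB.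
rewrite lee_fin -/(vel1 x) in h1; rewrite lee_fin -/(vel2 x) in h2.
have sq (p : R) : `|p| <= B -> p ^+ 2 <= B ^+ 2.
  move=> pB; rewrite -[p ^+ 2]ger0_norm ?sqr_ge0// normrX.
  by rewrite ler_sqr ?nnegrE// (le_trans _ pB).
by have := sq _ h1; have := sq _ h2; rewrite /sqr_speed; lra.
Qed.

(** Solve the third difference for the value at [x]; the Cauchy-Schwarz inequality
    gives [20 = 1 + 9 + 9 + 1] from its coefficients. *)
Lemma sqr_speed_shift_le x h (e : R) :
  diff3_const R * (M * (enorm h * (cyl_r x + enorm h))) <= e ->
  sqr_speed x <= 20 * (sqr_speed (x + (1 : R) *: h) + sqr_speed (x + (2 : R) *: h) +
    sqr_speed (x + (3 : R) *: h)) + 40 * e ^+ 2.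
Proof.
move=> he.
have sq0 z : 0 <= sqr_speed z by rewrite addr_ge0 ?sqr_ge0.
have e0 : 0 <= e ^+ 2 by exact: sqr_ge0.
have [h0|h0] := eqVneq (enorm h) 0.
  rewrite (enorm_eq0 h0) !scaler0 addr0; have := sq0 x; lra.
have {}h0 : 0 < enorm h by rewrite lt_neqAle eq_sym h0 enorm_ge0.
have d1 := le_trans (kern_conv_diff3_le mg M0 L0 gM gL measurable_density1 density1_le x h0) he.
have d2 := le_trans (kern_conv_diff3_le mg M0 L0 gM gL measurable_density2 density2_le x h0) he.
have key (a b c d : R) : `|d - 3 * c + 3 * b - a| <= e ->
    a ^+ 2 <= 20 * (b ^+ 2 + c ^+ 2 + d ^+ 2) + 20 * e ^+ 2.
  move=> hd; set w := d - 3 * c + 3 * b - a in hd.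
  have we : w ^+ 2 <= e ^+ 2.
    rewrite -[w ^+ 2]ger0_norm ?sqr_ge0// normrX.
    by rewrite ler_sqr ?nnegrE// (le_trans _ hd).
  have -> : a = 3 * b - 3 * c + d - w by rewrite /w; ring.
  suff : (3 * b - 3 * c + d - w) ^+ 2 <= 20 * (b ^+ 2 + c ^+ 2 + d ^+ 2 + w ^+ 2) by lra.
  rewrite -subr_ge0.
  have -> : 20 * (b ^+ 2 + c ^+ 2 + d ^+ 2 + w ^+ 2) - (3 * b - 3 * c + d - w) ^+ 2 =
    (3 * b + 3 * c) ^+ 2 + (b - 3 * d) ^+ 2 + (b + 3 * w) ^+ 2 +
    (c + 3 * d) ^+ 2 + (c - 3 * w) ^+ 2 + (d + w) ^+ 2 by ring.
  by rewrite !addr_ge0 ?sqr_ge0.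
have := key _ _ _ _ d1; have := key _ _ _ _ d2.
rewrite /sqr_speed /vel1 /vel2.
move: (kern_conv density1 x) (kern_conv density2 x)
  (kern_conv density1 _) (kern_conv density2 _)
  (kern_conv density1 _) (kern_conv density2 _)
  (kern_conv density1 _) (kern_conv density2 _).
by move=> a1 a2 b1 b2 c1 c2 f1 f2; lra.
Qed.

Hypothesis mspeed : measurable_fun setT sqr_speed.
Variable F : R.
Hypothesis sqr_speedF : (I3 sqr_speed <= F%:E)%E.

Lemma mnn_sqr_speed : mnn sqr_speed.
Proof. by split => // x; rewrite addr_ge0 ?sqr_ge0. Qed.

(** Average [sqr_speed_shift_le] over [h] in a cube of half side [s].  The points
    [x + k h] with [k <= 3] satisfy [|k h|^2 <= 27 s^2], where the weight
    [28 s^2 / (s^2 + |.|^2)] is at least [1]. *)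
Lemma sqr_speed_le_average (s B : R) x : 0 < s ->
  (I3 (fun y => (28 * s ^+ 2 * (sqr_speed y * lorentz s (x - y)))%R) <= B%:E)%E ->
  sqr_speed x <= 8 * B / s ^+ 3 + 40 * (4 * diff3_const R * (M * (s * (cyl_r x + s)))) ^+ 2.
Proof.
move=> s0 IB.
set e := 4 * diff3_const R * _.
pose Phi y := 28 * s ^+ 2 * (sqr_speed y * lorentz s (x - y)).
have s28 : 0 <= 28 * s ^+ 2 by rewrite mulr_ge0 ?sqr_ge0.
have Phi0 : mnn Phi.
  by apply: mnnZ => //; apply: mnnM mnn_sqr_speed (mnn_sub x (mnn_lorentz s)).
have sq0 z : 0 <= sqr_speed z by exact: mnn_ge0 mnn_sqr_speed.
have cube_le h : cube s h -> sqn h <= 3 * s ^+ 2.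
  rewrite sqnE => -[[]] /=; rewrite !in_itv/= => /andP[? ?] /andP[? ?] /andP[? ?].
  by nra.
have sqr_speed_Phi h (k : R) : cube s h -> 0 <= k <= 3 -> sqr_speed (x + k *: h) <= Phi (x + k *: h).
  move=> sh k3; rewrite /Phi mulrCA ler_peMr// /lorentz.
  have -> : x - (x + k *: h) = (- k) *: h by rewrite opprD addrA subrr add0r scaleNr.
  rewrite sqnZ ler_pdivlMr ?mul1r.
    have := cube_le _ sh; have := sqn_ge0 h; have : k ^+ 2 <= 9 by nra.
    by rewrite sqrrN; nra.
  by rewrite ltr_wpDr ?exprn_gt0// mulr_ge0 ?sqr_ge0 ?sqn_ge0.
have Ce h : cube s h -> diff3_const R * (M * (enorm h * (cyl_r x + enorm h))) <= e.
  move=> sh; have hs : enorm h <= 2 * s.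
    apply: ler_sqrP; first by rewrite mulr_ge0// ltW.
    by rewrite sqr_enorm; have := cube_le _ sh; have := sqr_ge0 s; lra.
  have c0 : 0 <= diff3_const R by rewrite /diff3_const; lra.
  rewrite /e (_ : 4 * diff3_const R * _ = diff3_const R * (M * (4 * (s * (cyl_r x + s))))); last by ring.
  apply: ler_wpM2l => //; apply: ler_wpM2l; first exact: ltW.
  have := enorm_ge0 h; have := cyl_r_ge0 x; nra.
pose G h := 20 * (Phi (x + (1 : R) *: h) + Phi (x + (2 : R) *: h) +
  Phi (x + (3 : R) *: h)) + 40 * e ^+ 2 * \1_(cube s) h.
have Pk (k : R) : 0 < k -> mnn (fun h => Phi (x + k *: h)).
  by move=> k0; have [_ m _] := scales3_affine x k0; exact: (mnn_comp m).
have IPk (k : R) : 1 <= k -> (I3 (fun h => Phi (x + k *: h)%R) <= B%:E)%E.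
  move=> k1; have k0 : 0 < k by rewrite (lt_le_trans _ k1).
  rewrite (I3_scales (scales3_affine x k0) Phi0).
  apply: le_trans (IB); rewrite -[leRHS]mul1e.
  apply: lee_wpmul2r; first exact: I3_ge0.
  by rewrite lee_fin invf_le1 ?exprn_gt0// exprn_ege1.
have c1 : mnn (\1_(cube s) : R3 R -> R) := mnn_indic (@measurable_cube R s).
have P3 := mnnD (mnnD (Pk 1 ltr01) (Pk 2 (ltr0n _ 2))) (Pk 3 (ltr0n _ 3)).
have e20 : 0 <= 40 * e ^+ 2 by rewrite mulr_ge0// sqr_ge0.
have G0 : mnn G := mnnD (mnnZ (ler0n _ 20) P3) (mnnZ e20 c1).
have : (I3 (fun h => (sqr_speed x * \1_(cube s) h)%R) <= I3 G)%E.
  apply: I3_le => //; first exact: mnnZ.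
  move=> h; rewrite /G indicE; have [/set_mem sh|_] := boolP (h \in cube s).
    rewrite !mulr1; apply: le_trans (sqr_speed_shift_le (Ce h sh)) _.
    rewrite lerD2r ler_wpM2l// !lerD//; apply: sqr_speed_Phi => //; lra.
  rewrite !mulr0 addr0 mulr_ge0//; exact: mnn_ge0 P3.
rewrite I3Z// I3_cube ?(ltW s0)// /G I3D; [|exact: mnnZ|exact: mnnZ].
rewrite I3Z// I3Z// I3_cube ?(ltW s0)//.
rewrite (I3D (mnnD (Pk 1 ltr01) (Pk 2 (ltr0n _ 2))) (Pk 3 (ltr0n _ 3))).
rewrite (I3D (Pk 1 ltr01) (Pk 2 (ltr0n _ 2))).
move: (IPk 1 (lexx _)) (IPk 2 ltac:(lra)) (IPk 3 ltac:(lra)).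
move: (I3 (fun h => Phi _)) (I3 (fun h => Phi _)) (I3 (fun h => Phi _)) => p3 p2 p1 b1 b2 b3 h.
have h3 : (20%:E * (p1 + p2 + p3) <= (20 * (3 * B))%:E)%E.
  rewrite (EFinM 20); apply: lee_wpmul2l; first by rewrite lee_fin.
  by apply: le_trans (leeD (leeD b1 b2) b3) _; rewrite -!EFinD lee_fin; lra.
move: (le_trans h (leeD2r _ h3)).
rewrite -!EFinM -EFinD lee_fin => {}h.
have s3 : 0 < s ^+ 3 by rewrite exprn_gt0.
have B0 : 0 <= B by rewrite -lee_fin (le_trans _ IB)// I3_ge0.
rewrite -(ler_pM2r s3).
have -> : (8 * B / s ^+ 3 + 40 * e ^+ 2) * s ^+ 3 = 8 * B + 40 * e ^+ 2 * s ^+ 3.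
  by field; rewrite gt_eqF.
move: h; rewrite exprMn (_ : 2 ^+ 3 = 8); last by ring.
move: (sqr_speed x) (e ^+ 2) => a b.
by rewrite !mulrA; lra.
Qed.

Lemma sqr_speed_le_ball (s : R) x : 0 < s ->
  sqr_speed x <= 8 * (28 * F) / s ^+ 3 + 40 * (4 * diff3_const R * (M * (s * (cyl_r x + s)))) ^+ 2.
Proof.
move=> s0; apply: sqr_speed_le_average => //.
have w0 y : 0 <= lorentz s (x - y) by exact: mnn_ge0 (mnn_lorentz s).
have le1 : (I3 (fun y => (28 * s ^+ 2 * (sqr_speed y * lorentz s (x - y)))%R) <=
    I3 (fun y => (28 * sqr_speed y)%R))%E.
  apply: I3_le.
  - apply: mnnZ; first by rewrite mulr_ge0 ?sqr_ge0.
    by apply: mnnM mnn_sqr_speed (mnn_sub x (mnn_lorentz s)).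
  - exact: mnnZ (ler0n _ 28) mnn_sqr_speed.
  move=> y; rewrite (_ : 28 * s ^+ 2 * _ = 28 * (sqr_speed y * (s ^+ 2 * lorentz s (x - y)))); last by ring.
  apply: ler_wpM2l => //; apply: ler_piMr; first exact: mnn_ge0 mnn_sqr_speed.
  have q0 := sqn_ge0 (x - y); have s2 : 0 < s ^+ 2 by rewrite exprn_gt0.
  by rewrite /lorentz ler_pdivrMr ?mul1r; lra.
apply: (le_trans le1); rewrite I3Z//; last exact: mnn_sqr_speed.
by rewrite (EFinM 28); apply: lee_wpmul2l; rewrite ?lee_fin.
Qed.

Lemma sqr_speed_le_torus (s : R) x : 0 < s -> 0 < cyl_r x ->
  sqr_speed x <= 8 * (28 * 32 * F * s / cyl_r x) / s ^+ 3 +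
    40 * (4 * diff3_const R * (M * (s * (cyl_r x + s)))) ^+ 2.
Proof.
move=> s0 r0; apply: sqr_speed_le_average => //.
have s28 : 0 <= 28 * s ^+ 2 by rewrite mulr_ge0 ?sqr_ge0.
rewrite I3Z//; last by apply: mnnM mnn_sqr_speed (mnn_sub x (mnn_lorentz s)).
have xr : rsq x = cyl_r x ^+ 2 by rewrite sqr_cyl_r.
have h := I3_rot_invariant mnn_sqr_speed sqr_speed_rot_invariant r0 xr s0.
have c0 : 0 <= 32 / (cyl_r x * s) by rewrite divr_ge0// mulr_ge0// ltW.
have {}h := le_trans h (lee_wpmul2l (_ : (0 <= (32 / (cyl_r x * s))%:E)%E) sqr_speedF).
have -> : 28 * 32 * F * s / cyl_r x = 28 * s ^+ 2 * (32 / (cyl_r x * s) * F).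
  by field; rewrite !gt_eqF.
rewrite (EFinM (28 * s ^+ 2)) (EFinM (32 / _)); apply: lee_wpmul2l; rewrite ?lee_fin//.
by apply: h; rewrite lee_fin.
Qed.

End velocity_estimates.

(** * Optimization over the length scales *)

Section optimization.
Variable R : realType.

Lemma root_exists (a : R) n : 0 < a -> exists2 s, 0 < s & s ^+ n.+1 = a.
Proof.
move=> a0; exists (a `^ (n.+1%:R)^-1); first exact: powR_gt0.
by rewrite -powR_mulrn ?powR_ge0// -powRrM mulVf ?pnatr_eq0// powRr1// ltW.
Qed.

Lemma cube_le_mul (p q v : R) : 0 <= v -> 0 <= p -> 0 <= q -> v <= p -> v <= q ->
  v ^+ 3 <= p * q ^+ 2.
Proof.
move=> v0 p0 q0 vp vq; rewrite exprS; apply: ler_pM => //; first exact: sqr_ge0.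
by rewrite lerXn2r ?nnegrE.
Qed.

Lemma ler_root (a b : R) n : 0 <= a -> 0 <= b -> a ^+ n.+1 <= b ^+ n.+1 -> a <= b.
Proof. by move=> a0 b0; rewrite ler_pXn2r ?nnegrE. Qed.

Definition global_const : R := 2 * (64 * 4) ^+ 2 + 2 * (128 * 4) ^+ 2.
Definition decay_const : R := 2 * (128 * 4) ^+ 2.
Definition average_const : R := 8 * 28 * 32 + 40 * (4 * diff3_const R) ^+ 2 * 4.
(** The sum covers the three cases of [sqr_speed_cube_le]. *)
Definition bound_const : R := decay_const * average_const ^+ 2 + average_const ^+ 3 + global_const ^+ 3.

Section one_point.
Variables (M L F r v : R).
Hypotheses (M0 : 0 < M) (L0 : 0 < L) (F0 : 0 < F) (r0 : 0 < r) (v0 : 0 <= v).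
Hypothesis H1 : forall rho lam, 0 < rho -> 0 < lam ->
  v <= 2 * (64 * (M * ((r + rho) * rho) + lam * L + M / (lam * rho))) ^+ 2.
Hypothesis H2 : forall rho lam, 0 < rho -> 0 < lam ->
  v <= 2 * (128 * (M * (r * rho) + L / (r ^+ 2 * rho) + lam * L + M / (lam * r))) ^+ 2.
Hypothesis H3 : forall s, 0 < s ->
  v <= 8 * (28 * F) / s ^+ 3 + 40 * (4 * diff3_const R * (M * (s * (r + s)))) ^+ 2.
Hypothesis H4 : forall s, 0 < s ->
  v <= 8 * (28 * 32 * F * s / r) / s ^+ 3 + 40 * (4 * diff3_const R * (M * (s * (r + s)))) ^+ 2.

(** With [sig^2 = L / (M r)], the choices [rho = sig / r] and [lam = 1 / (r sig)]
    make the four terms of the bound equal to [M sig]. *)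
Lemma sqr_speed_decay : v <= decay_const * (M * L / r).
Proof.
pose sig := Num.sqrt (L / (M * r)).
have q0 : 0 < L / (M * r) by rewrite divr_gt0// mulr_gt0.
have s0 : 0 < sig by rewrite sqrtr_gt0.
have sE : sig ^+ 2 = L / (M * r) by rewrite sqr_sqrtr// ltW.
have LE : L = M * r * sig ^+ 2 by rewrite sE; field; rewrite !gt_eqF.
have sr0 : 0 < sig / r by rewrite divr_gt0.
have rs0 : 0 < (r * sig)^-1 by rewrite invr_gt0 mulr_gt0.
apply: le_trans (H2 sr0 rs0) _.
rewrite LE le_eqVlt; apply/orP; left; apply/eqP; rewrite /decay_const.
by field; rewrite !gt_eqF.
Qed.

(** Close to the axis, [rho = d] and [lam = d^-3] make every term of size
    [M d^2]; elsewhere [sqr_speed_decay] is already better. *)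
Lemma sqr_speed_global (d : R) : 0 < d -> L = M * d ^+ 5 -> v <= global_const * (M ^+ 2 * d ^+ 4).
Proof.
move=> d0 LE.
have [rd|dr] := leP r d.
  have h3 : 0 < d ^- 3 by rewrite invr_gt0 exprn_gt0.
  apply: le_trans (H1 d0 h3) _.
  have e1 : d ^- 3 * L = M * d ^+ 2 by rewrite LE; field; rewrite gt_eqF.
  have e2 : M / (d ^- 3 * d) = M * d ^+ 2 by field; rewrite gt_eqF.
  rewrite e1 e2.
  have h1 : M * ((r + d) * d) <= 2 * (M * d ^+ 2).
    rewrite (_ : 2 * (M * d ^+ 2) = M * ((d + d) * d)); last by ring.
    by apply: ler_wpM2l; [exact: ltW|apply: ler_wpM2r; [exact: ltW|lra]].
  have h0 : 0 <= M * ((r + d) * d) by rewrite !mulr_ge0 ?addr_ge0// ltW.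
  have d2 : 0 <= M * d ^+ 2 by rewrite mulr_ge0 ?sqr_ge0// ltW.
  apply: (@le_trans _ _ (2 * (64 * (4 * (M * d ^+ 2))) ^+ 2)).
    apply: ler_wpM2l => //; rewrite ler_sqr ?nnegrE; lra.
  have d4 : 0 <= M ^+ 2 * d ^+ 4 by rewrite mulr_ge0 ?exprn_ge0// ltW.
  rewrite (_ : (64 * (4 * (M * d ^+ 2))) ^+ 2 = (64 * 4) ^+ 2 * (M ^+ 2 * d ^+ 4)); last by ring.
  by rewrite /global_const mulrA; apply: ler_wpM2r => //; rewrite lerDl mulr_ge0 ?sqr_ge0.
apply: le_trans sqr_speed_decay _; rewrite LE.
have d4 : 0 <= M ^+ 2 * d ^+ 4 by rewrite mulr_ge0 ?exprn_ge0// ltW.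
apply: (@le_trans _ _ (decay_const * (M ^+ 2 * d ^+ 4))); last first.
  by apply: ler_wpM2r => //; rewrite /global_const /decay_const lerDr mulr_ge0 ?sqr_ge0.
apply: ler_wpM2l; first by rewrite /decay_const mulr_ge0 ?sqr_ge0.
rewrite ler_pdivrMr// (_ : M * (M * d ^+ 5) = M ^+ 2 * d ^+ 4 * d); last by ring.
by apply: ler_wpM2l => //; exact: ltW.
Qed.

Lemma consts_ge0 : [/\ 0 <= decay_const, 0 <= average_const & 0 <= global_const].
Proof.
split; rewrite /decay_const /average_const /global_const.
- by rewrite mulr_ge0 ?sqr_ge0.
- have := sqr_ge0 (4 * diff3_const R); lra.
- by rewrite addr_ge0// mulr_ge0 ?sqr_ge0.
Qed.

Lemma error_term_le (y z : R) : 0 <= y -> y <= z ->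
  40 * (4 * diff3_const R * y) ^+ 2 <= 40 * (4 * diff3_const R * z) ^+ 2.
Proof.
move=> y0 yz; have c0 : 0 <= 4 * diff3_const R by rewrite /diff3_const; lra.
apply: ler_wpM2l => //; rewrite ler_sqr ?nnegrE; first exact: ler_wpM2l.
- exact: mulr_ge0.
- by apply: mulr_ge0 => //; exact: le_trans yz.
Qed.

(** With [F] for the energy, [F <= M^2 r^7] means that the optimal averaging length
    [s] is below [r]: then the error term is [(M s r)^2], and the bound by the ring
    and the decay in [r] apply.  Otherwise the point is close to the axis on the
    scale [s], the error term is [(M s^2)^2], and the product [s^7 d^5] dominates
    [min(s, d)^12]. *)
Lemma sqr_speed_cube_le : v ^+ 3 <= bound_const * (F * M ^+ 3 * L).
Proof.
have [k2 k4 k1] := consts_ge0.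
have [|d d0 dE] := @root_exists (L / M) 4; first by rewrite divr_gt0.
have LE : L = M * d ^+ 5 by rewrite dE; field; rewrite gt_eqF.
have k0 : [/\ 0 <= decay_const * average_const ^+ 2, 0 <= average_const ^+ 3 & 0 <= global_const ^+ 3].
  by split; [apply: mulr_ge0 => //; exact: sqr_ge0| |]; exact: exprn_ge0.
have [k24 k43 k13] := k0.
have p0 : 0 <= F * M ^+ 3 * L by rewrite !mulr_ge0 ?exprn_ge0 ?(ltW M0) ?(ltW F0) ?(ltW L0).
have Kle (k : R) : k <= bound_const -> k * (F * M ^+ 3 * L) <= bound_const * (F * M ^+ 3 * L).
  by move=> kK; apply: ler_wpM2r.
have [Fr|Fr] := leP F (M ^+ 2 * r ^+ 7).
  have [|s s0 sE] := @root_exists (F / (M ^+ 2 * r ^+ 3)) 3.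
    by rewrite divr_gt0// mulr_gt0// exprn_gt0.
  have FE : F = M ^+ 2 * r ^+ 3 * s ^+ 4 by rewrite sE; field; rewrite !gt_eqF.
  have sr : s <= r.
    apply: (@ler_root _ _ 3); [exact: ltW|exact: ltW|].
    rewrite sE ler_pdivrMr ?mulr_gt0 ?exprn_gt0//.
    by apply: le_trans Fr _; rewrite le_eqVlt; apply/orP; left; apply/eqP; ring.
  have h : v <= average_const * (M ^+ 2 * s ^+ 2 * r ^+ 2).
    have Y : M * (s * (r + s)) <= 2 * (M * s * r).
      rewrite (_ : 2 * (M * s * r) = M * (s * (r + r))); last by ring.
      by apply: ler_wpM2l; [exact: ltW|apply: ler_wpM2l; [exact: ltW|lra]].
    apply: le_trans (H4 s0) (le_trans (lerD (lexx _) (error_term_le _ Y)) _).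
      by rewrite !mulr_ge0 ?addr_ge0// ltW.
    rewrite FE le_eqVlt; apply/orP; left; apply/eqP; rewrite /average_const.
    by field; rewrite !gt_eqF.
  apply: (@le_trans _ _ (decay_const * average_const ^+ 2 * (F * M ^+ 3 * L))).
    have p1 : 0 <= decay_const * (M * L / r) by apply: mulr_ge0 => //; rewrite divr_ge0 ?mulr_ge0// ltW.
    have p2 : 0 <= average_const * (M ^+ 2 * s ^+ 2 * r ^+ 2).
      apply: mulr_ge0 => //; apply: mulr_ge0; last exact: sqr_ge0.
      by apply: mulr_ge0; exact: sqr_ge0.
    apply: le_trans (cube_le_mul v0 p1 p2 sqr_speed_decay h) _.
    rewrite FE le_eqVlt; apply/orP; left; apply/eqP; field; rewrite gt_eqF//.
  by apply: Kle; rewrite /bound_const; lra.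
have [|s s0 sE] := @root_exists (F / M ^+ 2) 6; first by rewrite divr_gt0// exprn_gt0.
have FE : F = M ^+ 2 * s ^+ 7 by rewrite sE; field; rewrite !gt_eqF.
have rs : r <= s.
  apply: (@ler_root _ _ 6); [exact: ltW|exact: ltW|].
  by rewrite sE ler_pdivlMr ?exprn_gt0// mulrC ltW.
have h : v <= average_const * (M ^+ 2 * s ^+ 4).
  have Y : M * (s * (r + s)) <= 2 * (M * s * s).
    rewrite (_ : 2 * (M * s * s) = M * (s * (s + s))); last by ring.
    by apply: ler_wpM2l; [exact: ltW|apply: ler_wpM2l; [exact: ltW|lra]].
  apply: le_trans (H3 s0) (le_trans (lerD (lexx _) (error_term_le _ Y)) _).
    by rewrite !mulr_ge0 ?addr_ge0// ltW.
  have -> : 8 * (28 * F) / s ^+ 3 = 8 * 28 * (M ^+ 2 * s ^+ 4).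
    by rewrite FE; field; rewrite gt_eqF.
  have ms : 0 <= M ^+ 2 * s ^+ 4 by rewrite mulr_ge0 ?exprn_ge0// ltW.
  rewrite (_ : 40 * (4 * diff3_const R * (2 * (M * s * s))) ^+ 2 =
    40 * (4 * diff3_const R) ^+ 2 * 4 * (M ^+ 2 * s ^+ 4)); last by ring.
  by rewrite -mulrDl; apply: ler_wpM2r => //; rewrite /average_const; lra.
have h1 := sqr_speed_global d0 LE.
have P n m : 0 <= s ^+ n * d ^+ m by rewrite mulr_ge0 ?exprn_ge0 ?(ltW s0) ?(ltW d0).
have [sd|ds] := leP s d.
  apply: (@le_trans _ _ (average_const ^+ 3 * (F * M ^+ 3 * L))); last by apply: Kle; rewrite /bound_const; lra.
  apply: (@le_trans _ _ ((average_const * (M ^+ 2 * s ^+ 4)) ^+ 3)).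
    by rewrite lerXn2r ?nnegrE// (le_trans _ h).
  rewrite exprMn; apply: ler_wpM2l => //; rewrite FE LE.
  rewrite (_ : (M ^+ 2 * s ^+ 4) ^+ 3 = M ^+ 6 * s ^+ 7 * s ^+ 5); last by ring.
  rewrite (_ : M ^+ 2 * s ^+ 7 * M ^+ 3 * (M * d ^+ 5) =
    M ^+ 6 * s ^+ 7 * d ^+ 5); last by ring.
  apply: ler_wpM2l; first by rewrite mulr_ge0 ?exprn_ge0// ltW.
  by rewrite lerXn2r ?nnegrE// ltW.
apply: (@le_trans _ _ (global_const ^+ 3 * (F * M ^+ 3 * L))); last by apply: Kle; rewrite /bound_const; lra.
apply: (@le_trans _ _ ((global_const * (M ^+ 2 * d ^+ 4)) ^+ 3)).
  by rewrite lerXn2r ?nnegrE// (le_trans _ h1).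
rewrite exprMn; apply: ler_wpM2l => //; rewrite FE LE.
rewrite (_ : (M ^+ 2 * d ^+ 4) ^+ 3 = M ^+ 6 * d ^+ 5 * d ^+ 7); last by ring.
rewrite (_ : M ^+ 2 * s ^+ 7 * M ^+ 3 * (M * d ^+ 5) =
  M ^+ 6 * d ^+ 5 * s ^+ 7); last by ring.
apply: ler_wpM2l; first by rewrite mulr_ge0 ?exprn_ge0// ltW.
by rewrite lerXn2r ?nnegrE// ltW.
Qed.

End one_point.

End optimization.

(** * The velocity of an axisymmetric vorticity *)

Section pointwise_bound.
Variables (R : realType) (g : R3 R -> R).
Hypothesis mg : measurable_fun setT g.
Hypothesis ginv : rot_invariant g.
Hypothesis mspeed : measurable_fun setT (sqr_speed g).

Lemma sqr_speed_cube_le_pos (M L F : R) x : 0 < M -> 0 < L -> 0 < F ->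
  {ae leb3, forall y, `|g y| <= M} -> (I3 (moment g) <= L%:E)%E ->
  (I3 (sqr_speed g) <= F%:E)%E -> 0 < cyl_r x ->
  sqr_speed g x ^+ 3 <= bound_const R * (F * M ^+ 3 * L).
Proof.
move=> M0 L0 F0 gM gL gF r0.
apply: (sqr_speed_cube_le M0 L0 F0 r0).
- by rewrite addr_ge0 ?sqr_ge0.
- move=> rho lam rho0 lam0; apply: (sqr_speed_le_majorant mg M0 L0 gM gL).
  exact: (majorant_le mg M0 L0 gM gL).
- move=> rho lam rho0 lam0; apply: (sqr_speed_le_majorant mg M0 L0 gM gL).
  exact: (majorant_le_axis mg M0 L0 gM ginv gL).
- by move=> s s0; exact: (sqr_speed_le_ball mg M0 L0 gM gL mspeed gF x s0).
- by move=> s s0; exact: (sqr_speed_le_torus mg M0 L0 gM gL ginv mspeed gF s0 r0).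
Qed.

(** The optimal lengths involve the quotients [L / M] and [F / M^2].  The
    degenerate cases follow by increasing [M], [L] and [F] to [M + e], [L + e] and
    [F + e] and letting [e] tend to [0]. *)
Lemma sqr_speed_cube_le_ge0 (M L F : R) x : 0 <= M -> 0 <= L -> 0 <= F ->
  {ae leb3, forall y, `|g y| <= M} -> (I3 (moment g) <= L%:E)%E ->
  (I3 (sqr_speed g) <= F%:E)%E -> 0 < cyl_r x ->
  sqr_speed g x ^+ 3 <= bound_const R * (F * M ^+ 3 * L).
Proof.
move=> M0 L0 F0 gM gL gF r0.
pose f (e : R) := bound_const R * ((F + e) * (M + e) ^+ 3 * (L + e)).
have cf : f e @[e --> 0^'+] --> f 0.
  apply: cvg_at_right_filter.
  have ca (a : R) : (a + e) @[e --> (0 : R)] --> a + 0.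
    by apply: cvgD; [exact: cvg_cst|exact: cvg_id].
  apply: cvgM; first exact: cvg_cst.
  apply: cvgM; last exact: ca.
  apply: cvgM; first exact: ca.
  apply: (cvg_comp (fun e => M + e) (fun e => e ^+ 3) (ca M)).
  exact: exprn_continuous.
have f0 : f 0 = bound_const R * (F * M ^+ 3 * L) by rewrite /f !addr0.
rewrite -f0; apply: (cvgr_to_ge cf).
near=> e; have e0 : 0 < e by near: e; exact: nbhs_right_gt.
apply: sqr_speed_cube_le_pos => //; rewrite ?ltr_wpDl//.
- by apply: ae_imp gM => y gy; rewrite ler_wpDr// ltW.
- by apply: le_trans gL _; rewrite lee_fin lerDl ltW.
- by apply: le_trans gF _; rewrite lee_fin lerDl ltW.
Unshelve. all: by end_near. Qed.

End pointwise_bound.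

Section velocity_of_vorticity.
Variables (R : realType) (omega : R -> R -> R).
Implicit Types (x y : R3 R).

Definition omega_r x : R := axisym omega x / cyl_r x.

Lemma omega_r_rot_invariant : rot_invariant omega_r.
Proof.
move=> c s y c0 cs; rewrite /omega_r /axisym.
have -> : cyl_r (rot c s y) = cyl_r y; last by [].
rewrite /cyl_r /rot/=; congr Num.sqrt.
transitivity ((c ^+ 2 + s ^+ 2) * (y.1.1 ^+ 2 + y.1.2 ^+ 2)); first by ring.
by rewrite cs mul1r.
Qed.

Lemma moment_omega_r y : moment omega_r y = `|cyl_r y * axisym omega y|.
Proof.
rewrite /moment /omega_r -sqr_cyl_r !normrM normfV (ger0_norm (cyl_r_ge0 y)).
have [->|r0] := eqVneq (cyl_r y) 0; first by rewrite expr0n/= !mul0r.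
by field.
Qed.

Lemma vorticity1 y : (vorticity omega y).1.1 = - density2 omega_r y.
Proof.
rewrite /vorticity /e_theta /density2 /omega_r /=.
by rewrite /GRing.scale/=; ring.
Qed.

Lemma vorticity2 y : (vorticity omega y).1.2 = density1 omega_r y.
Proof.
rewrite /vorticity /e_theta /density1 /omega_r /=.
by rewrite /GRing.scale/=; ring.
Qed.

Lemma vorticity3 y : (vorticity omega y).2 = 0.
Proof. by rewrite /vorticity /e_theta /= /GRing.scale/= mulr0. Qed.

(** The vorticity is horizontal, so the horizontal part of the curl consists of
    vertical derivatives of the other two potentials. *)
Lemma potential3 : (fun x => (vec_inv_neg_laplacian (vorticity omega) x).2) = cst 0.
Proof.
apply/funext => x; rewrite /vec_inv_neg_laplacian/= /inv_neg_laplacian.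
transitivity (\int[@leb3 R]_y (0 : R)).
  by apply: eq_Rintegral => y _; rewrite -[X in X / _]/((vorticity omega y).2) vorticity3 mul0r.
by rewrite /Rintegral integral0.
Qed.

Variables (M L : R).
Hypotheses (mg : measurable_fun setT omega_r) (M0 : 0 < M) (L0 : 0 < L).
Hypothesis gM : {ae leb3, forall y, `|omega_r y| <= M}.
Hypothesis gL : (I3 (moment omega_r) <= L%:E)%E.

Lemma velocity1 x : (velocity omega x).1.1 = (4 * pi)^-1 * vel1 omega_r x.
Proof.
rewrite /velocity /biot_savart /curl /= potential3 derive_cst sub0r.
rewrite /vec_inv_neg_laplacian/=.
have -> : (fun y => inv_neg_laplacian (fun y => (vorticity omega y).1.2) y) =
    potential (density1 omega_r).
  apply/funext => y; apply: eq_Rintegral => z _; by rewrite vorticity2.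
rewrite (potential_derive mg M0 L0 gM gL (measurable_density1 mg) (@density1_le _ _)).
by rewrite mulNr opprK.
Qed.

Lemma velocity2 x : (velocity omega x).1.2 = (4 * pi)^-1 * vel2 omega_r x.
Proof.
rewrite /velocity /biot_savart /curl /= potential3 derive_cst subr0.
rewrite /vec_inv_neg_laplacian/=.
pose v (y : R3 R) : R := - density2 omega_r y.
have mv : measurable_fun setT v.
  by apply: measurableT_comp => //; exact: measurable_density2.
have vg y : `|v y| <= swirl omega_r y by rewrite normrN density2_le.
have -> : (fun y => inv_neg_laplacian (fun y => (vorticity omega y).1.1) y) =
    potential v.
  apply/funext => y; apply: eq_Rintegral => z _; by rewrite vorticity1.
rewrite (potential_derive mg M0 L0 gM gL mv vg).
rewrite mulNr -mulrN; congr (_ * _); rewrite /vel2 /kern_conv -mulN1r.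
have i2 := integrable_kern mg M0 L0 gM gL mv vg x.
rewrite -RintegralZl//.
by apply: eq_Rintegral => y _; rewrite /v; ring.
Qed.

Lemma sqr_velocity12 x :
  (velocity omega x).1.1 ^+ 2 + (velocity omega x).1.2 ^+ 2 =
  (4 * pi) ^- 2 * sqr_speed omega_r x.
Proof.
rewrite velocity1 velocity2 /sqr_speed -exprVn.
by move: (4 * pi)^-1 (vel1 _ _) (vel2 _ _) => a b c; ring.
Qed.

Lemma velocity_r_sqr_le x : 0 < cyl_r x ->
  velocity_r omega x ^+ 2 <= (4 * pi) ^- 2 * sqr_speed omega_r x.
Proof.
move=> r0; rewrite -sqr_velocity12 /velocity_r.
move: (velocity omega x) => u.
have -> : dot u (e_r x) = (u.1.1 * x.1.1 + u.1.2 * x.1.2) / cyl_r x.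
  by rewrite /dot /e_r/= mulr0 addr0; ring.
move: u.1.1 u.1.2 => a b.
have rE : cyl_r x ^+ 2 = x.1.1 ^+ 2 + x.1.2 ^+ 2 by exact: sqr_cyl_r.
rewrite expr_div_n ler_pdivrMr ?exprn_gt0// rE.
by have := sqr_ge0 (a * x.1.2 - b * x.1.1); lra.
Qed.

(** On the axis the radial direction is the zero vector. *)
Lemma velocity_r_axis x : cyl_r x = 0 -> velocity_r omega x = 0.
Proof.
move=> r0; rewrite /velocity_r; move: (velocity omega x) => u.
by rewrite /dot /e_r/= r0 invr0 !mulr0 !addr0.
Qed.

End velocity_of_vorticity.

(** * Norms and sixth roots *)

Section norms.
Variable R : realType.
Implicit Types (f : R3 R -> R).

Lemma leb3_gt0 : (0 < @leb3 R setT)%E.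
Proof.
apply: (@lt_le_trans _ _ (leb3 (cube (1 : R)))).
  by rewrite leb3_cube// lte_fin exprn_gt0// mulr1.
by apply: le_measure => //; rewrite inE//; exact: measurable_cube.
Qed.

Lemma Lfun_measurable p f : f \in Lfun leb3 p -> measurable_fun setT f.
Proof. by move=> /sub_Lfun_mfun; rewrite inE. Qed.

Lemma Lfun_norm p f : f \in Lfun leb3 p ->
  exists2 a : R, 0 <= a & ('N[leb3]_p[EFin \o f] = a%:E)%E.
Proof.
move=> /sub_Lfun_finLfun; rewrite inE /finite_norm => foo.
have f0 := Lnorm_ge0 leb3 p (EFin \o f).
exists (fine 'N[leb3]_p[EFin \o f]%E); first by rewrite fine_ge0.
by rewrite fineK// ge0_fin_numE.
Qed.

Lemma LfunP_norm p f (a : R) : measurable_fun setT f ->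
  ('N[leb3]_p[EFin \o f] <= a%:E)%E -> f \in Lfun leb3 p.
Proof.
move=> mf fa; rewrite inE; apply/andP; split; rewrite inE//.
exact: le_lt_trans fa (ltry _).
Qed.

Lemma Lnormy_ae f (a : R) : ('N[leb3]_+oo[EFin \o f] = a%:E)%E ->
  {ae leb3, forall y, `|f y| <= a}.
Proof.
rewrite unlock ifT ?leb3_gt0// => fa.
have := @ess_sup_ge _ _ _ (@leb3 R) (abse \o (EFin \o f)); rewrite fa.
by apply: ae_imp => y; rewrite /= lee_fin.
Qed.

Lemma Lnormy_le f (a : R) : (forall y, `|f y| <= a) ->
  ('N[leb3]_+oo[EFin \o f] <= a%:E)%E.
Proof.
move=> fa; rewrite unlock ifT ?leb3_gt0//; apply/ess_supP.
exists set0; split => // y /=; apply; by rewrite lee_fin.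
Qed.

Lemma Lnorm2_sqr f (a : R) : 0 <= a -> ('N[leb3]_2%:E[EFin \o f] = a%:E)%E ->
  I3 (fun y => f y ^+ 2) = (a ^+ 2)%:E.
Proof.
move=> a0 fa; have := @powR_Lnorm _ _ _ (@leb3 R) (EFin \o f) 2 _.
rewrite fa poweR_EFin powR_mulrn// => -> //.
apply: eq_integral => y _; rewrite /= powR_mulrn//.
by rewrite real_normK// num_real.
Qed.

Lemma Lnorm2_lty f (a : R) : (I3 (fun y => (f y ^+ 2)%R) <= a%:E)%E ->
  ('N[leb3]_2%:E[EFin \o f] < +oo)%E.
Proof.
move=> fa; rewrite unlock /=; apply: poweR_lty; apply: le_lt_trans (ltry a).
apply: le_trans fa; rewrite le_eqVlt; apply/orP; left; apply/eqP.
apply: eq_integral => y _; rewrite /= powR_mulrn//.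
by rewrite real_normK// num_real.
Qed.

End norms.

Section sixth_root.
Variable R : realType.

Lemma powR_root (a : R) n : 0 <= a -> (a `^ (n.+1%:R)^-1) ^+ n.+1 = a.
Proof.
move=> a0; rewrite -powR_mulrn ?powR_ge0// -powRrM mulVf ?pnatr_eq0//.
by rewrite powRr1.
Qed.

Lemma bound_const_ge1 : 1 <= bound_const R.
Proof.
have [k2 k4 k1] := @consts_ge0 R.
rewrite /bound_const.
have : 0 <= decay_const R * average_const R ^+ 2 by rewrite mulr_ge0 ?sqr_ge0.
have : 0 <= average_const R ^+ 3 by rewrite exprn_ge0.
suff : 1 <= global_const R ^+ 3 by lra.
by rewrite exprn_ege1// /global_const; lra.
Qed.

(** Since [K >= 1], the constant [K] may stand for its own sixth root. *)
Lemma sixth_root_le (K e m l u : R) : 1 <= K -> 0 <= e -> 0 <= m -> 0 <= l -> 0 <= u ->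
  u ^+ 6 <= K * (e ^+ 2 * m ^+ 3 * l) ->
  u <= K * e `^ (3^-1) * m `^ (2^-1) * l `^ (6^-1).
Proof.
move=> K1 e0 m0 l0 u0 h.
have K0 : 0 <= K by lra.
apply: (@ler_root _ _ _ 5) => //; first by rewrite !mulr_ge0 ?powR_ge0.
apply: le_trans h _.
have e3 := powR_root 2 e0; have m2 := powR_root 1 m0; have l6 := powR_root 5 l0.
move: e3 m2 l6 (powR_ge0 e 3^-1) (powR_ge0 m 2^-1) (powR_ge0 l 6^-1).
move: (e `^ _) (m `^ _) (l `^ _) => a b c <- <- <- a0 b0 c0.
rewrite (_ : (K * a * b * c) ^+ 6 = K ^+ 6 * ((a ^+ 3) ^+ 2 * (b ^+ 2) ^+ 3 * c ^+ 6)); last by ring.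
apply: ler_wpM2r; first by rewrite !mulr_ge0 ?exprn_ge0.
by rewrite -{1}[K]expr1 ler_weXn2l.
Qed.

End sixth_root.

Theorem propositionA1 (R : realType) :
  exists C : R, 0 < C /\
    forall omega : R -> R -> R,
      let omega_div_r := fun x : R3 R => axisym omega x / cyl_r x in
      let r_omega := fun x : R3 R => cyl_r x * axisym omega x in
      let u := velocity omega in
      let ur := velocity_r omega in
      omega_div_r \in Lfun leb3 +oo%E ->
      r_omega \in Lfun leb3 1%:E ->
      L2_field u ->
      ur \in Lfun leb3 +oo%E /\
      ('N[leb3]_+oo[EFin \o ur] <=
         C%:E * 'N[leb3]_2%:E[EFin \o (@enorm R \o u)] `^ (3^-1)
              * 'N[leb3]_+oo[EFin \o omega_div_r] `^ (2^-1)
              * 'N[leb3]_1%:E[EFin \o r_omega] `^ (6^-1))%E.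
Proof.
exists (bound_const R); split; first by rewrite (lt_le_trans ltr01)// bound_const_ge1.
move=> omega omega_div_r r_omega u ur gLy rL1 [u1L u2L u3L].
have mg : measurable_fun setT (omega_r omega) := Lfun_measurable gLy.
have [M M0 ME] := Lfun_norm gLy; have gM := Lnormy_ae ME.
have [L L0 LE] := Lfun_norm rL1.
have gL : I3 (moment (omega_r omega)) = L%:E.
  rewrite -LE Lnorm1; apply: eq_integral => y _ /=; by rewrite moment_omega_r.
have M1 : 0 < M + 1 by rewrite ltr_wpDl.
have L1 : 0 < L + 1 by rewrite ltr_wpDl.
have gM1 : {ae leb3, forall y, `|omega_r omega y| <= M + 1}.
  by apply: ae_imp gM => y gy; rewrite ler_wpDr.
have gL1 : (I3 (moment (omega_r omega)) <= (L + 1)%:E)%E.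
  by rewrite gL lee_fin lerDl.
have velE : forall x, (u x).1.1 ^+ 2 + (u x).1.2 ^+ 2 =
    (4 * pi) ^- 2 * sqr_speed (omega_r omega) x := sqr_velocity12 mg M1 L1 gM1 gL1.
have urE : forall x, ur x = dot (u x) (e_r x) by [].
have ur_axis : forall x, cyl_r x = 0 -> ur x = 0 := @velocity_r_axis _ omega.
have ur_sqr : forall x, 0 < cyl_r x ->
    ur x ^+ 2 <= (4 * pi) ^- 2 * sqr_speed (omega_r omega) x :=
  fun x => velocity_r_sqr_le mg M1 L1 gM1 gL1 (x := x).
(* only the facts above matter now; the integrals that define the velocity are
   kept out of reach of conversion *)
clearbody u ur.
have mu1 := Lfun_measurable u1L; have mu2 := Lfun_measurable u2L.
have mu3 := Lfun_measurable u3L.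
have [a1 a10 E1] := Lfun_norm u1L; have [a2 a20 E2] := Lfun_norm u2L.
have [a3 a30 E3] := Lfun_norm u3L.
have I1 := Lnorm2_sqr a10 E1; have I2 := Lnorm2_sqr a20 E2.
have I4 := Lnorm2_sqr a30 E3.
have su : forall x, enorm (u x) ^+ 2 = (u x).1.1 ^+ 2 + (u x).1.2 ^+ 2 + (u x).2 ^+ 2.
  by move=> x; rewrite sqr_enorm sqnE.
have q1 : mnn (fun x => (u x).1.1 ^+ 2) by split=> [|x]; [exact: measurable_funX|exact: sqr_ge0].
have q2 : mnn (fun x => (u x).1.2 ^+ 2) by split=> [|x]; [exact: measurable_funX|exact: sqr_ge0].
have q3 : mnn (fun x => (u x).2 ^+ 2) by split=> [|x]; [exact: measurable_funX|exact: sqr_ge0].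
have q12 := mnnD q1 q2.
have IE : I3 (fun x => enorm (u x) ^+ 2) = (a1 ^+ 2 + a2 ^+ 2 + a3 ^+ 2)%:E.
  rewrite (_ : (fun x => _) = fun x => (u x).1.1 ^+ 2 + (u x).1.2 ^+ 2 + (u x).2 ^+ 2); last first.
    by apply/funext => x; exact: su.
  by rewrite I3D// I3D// I1 I2 I4.
have [e e0 EE] : exists2 e : R, 0 <= e & ('N[leb3]_2%:E[EFin \o (@enorm R \o u)] = e%:E)%E.
  have foo : ('N[leb3]_2%:E[EFin \o (@enorm R \o u)] < +oo)%E.
    by apply: (@Lnorm2_lty _ _ (a1 ^+ 2 + a2 ^+ 2 + a3 ^+ 2)); rewrite IE.
  exists (fine 'N[leb3]_2%:E[EFin \o (@enorm R \o u)]%E); first by rewrite fine_ge0// Lnorm_ge0.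
  by rewrite fineK// ge0_fin_numE// Lnorm_ge0.
have Ie : I3 (fun x => enorm (u x) ^+ 2) = (e ^+ 2)%:E := Lnorm2_sqr e0 EE.
have pi0 : 0 < 4 * pi :> R by rewrite mulr_gt0// pi_gt0.
have sE : sqr_speed (omega_r omega) = fun x => (4 * pi) ^+ 2 * ((u x).1.1 ^+ 2 + (u x).1.2 ^+ 2).
  apply/funext => x; rewrite velE mulrA mulfV ?mul1r//.
  by rewrite expf_neq0// gt_eqF.
have c0 : 0 <= (4 * pi : R) ^+ 2 by exact: sqr_ge0.
have msp : measurable_fun setT (sqr_speed (omega_r omega)).
  by rewrite sE; exact: (proj1 (mnnZ c0 q12)).
have gF : (I3 (sqr_speed (omega_r omega)) <= ((4 * pi) ^+ 2 * e ^+ 2)%:E)%E.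
  rewrite sE I3Z// (EFinM _ (e ^+ 2)); apply: lee_wpmul2l; first by rewrite lee_fin.
  rewrite -Ie; apply: I3_le => //.
    split=> [|x]; last exact: sqr_ge0.
    rewrite (_ : (fun x => _) = fun x => (u x).1.1 ^+ 2 + (u x).1.2 ^+ 2 + (u x).2 ^+ 2).
      exact: (proj1 (mnnD q12 q3)).
    by apply/funext => x; exact: su.
  by move=> x; rewrite su lerDl sqr_ge0.
have ur_le x : `|ur x| <= bound_const R * e `^ (3^-1) * M `^ (2^-1) * L `^ (6^-1).
  apply: sixth_root_le => //; first exact: bound_const_ge1.
  have [r0|r0] := eqVneq (cyl_r x) 0.
    rewrite ur_axis// normr0 expr0n/=.
    by rewrite !mulr_ge0 ?exprn_ge0// (le_trans ler01)// bound_const_ge1.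
  have {}r0 : 0 < cyl_r x by rewrite lt_neqAle eq_sym r0 cyl_r_ge0.
  have F0 : 0 <= (4 * pi) ^+ 2 * e ^+ 2 by rewrite mulr_ge0 ?sqr_ge0.
  have gL' : (I3 (moment (omega_r omega)) <= L%:E)%E by rewrite gL.
  have h := sqr_speed_cube_le_ge0 mg (@omega_r_rot_invariant _ omega) msp M0 L0 F0 gM gL' gF r0.
  have h2 := ur_sqr x r0.
  have p0 : 0 < (4 * pi : R) ^+ 2 by rewrite exprn_gt0.
  (* sqr_speed lacks the factor 1 / (4 pi): ((4 pi)^2 ur^2)^3 is at most
     bound_const (4 pi)^2 e^2 M^3 L, and (4 pi)^2 >= 1 absorbs the powers *)
  have p1 : 1 <= (4 * pi : R) ^+ 2.
    have h1 := @pihalf_ge1 R; have h4 : 1 <= 4 * pi :> R by lra.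
    exact: exprn_ege1.
  have ur6 : `|ur x| ^+ 6 = (ur x ^+ 2) ^+ 3.
    by rewrite -[ur x ^+ 2]real_normK ?num_real// -exprM.
  have s0 : 0 <= sqr_speed (omega_r omega) x by rewrite addr_ge0 ?sqr_ge0.
  have h3 : ((4 * pi) ^+ 2 * ur x ^+ 2) ^+ 3 <= sqr_speed (omega_r omega) x ^+ 3.
    have h5 : (4 * pi) ^+ 2 * ur x ^+ 2 <= sqr_speed (omega_r omega) x.
      by rewrite -(ler_pdivlMl _ _ p0).
    by rewrite lerXn2r ?nnegrE// mulr_ge0 ?sqr_ge0.
  have h4 := le_trans h3 h.
  rewrite ur6 -(ler_pM2l p0).
  move: h4; move: ((4 * pi) ^+ 2) p0 p1 => P p0 p1 h4.
  apply: le_trans (le_trans _ h4) _.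
    rewrite [leRHS](exprMn 3); apply: ler_wpM2r; first by rewrite exprn_ge0 ?sqr_ge0.
    by rewrite -{1}[P]expr1 ler_weXn2l.
  by rewrite le_eqVlt; apply/orP; left; apply/eqP; ring.
have urN := Lnormy_le ur_le.
have mur : measurable_fun setT ur.
  have mr := @measurable_cyl_r R.
  have mri : measurable_fun setT (fun x : R3 R => (cyl_r x)^-1).
    exact: (measurableT_comp (@measurable_invr R) mr).
  have -> : ur = fun x => ((u x).1.1 * x.1.1 + (u x).1.2 * x.1.2) * (cyl_r x)^-1.
    apply/funext => x; rewrite urE; move: (u x) => w.
    by rewrite /dot /e_r/= mulr0 addr0; ring.
  apply: measurable_funM => //.
  by apply: measurable_funD; apply: measurable_funM => //; exact: measurableT_comp.
split; first exact: LfunP_norm urN.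
by rewrite EE ME LE !poweR_EFin -!EFinM.
Qed.
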